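(* Let $n\in\{5,8,10,12\}$ and let $U\subset\mathbb{S}^1$ be any set of four pairwise non-parallel $\mathcal{O}_n$-directions such that the cross ratio of slopes of the directions of $U$, arranged in order of increasing angle with the positive real axis, does not map under the norm $N_{\mathbb{k}_n/\mathbb{Q}}$ to the set $N_2$. Then, for all cyclotomic model sets $\Lambda_n(t,W)\in\mathcal{M}(\mathcal{O}_n)$, the set $\mathcal{C}(\Lambda_n(t,W))$ is determined by the $X$-rays in the directions of $U$.
   Context: Identify $\mathbb{C}$ with $\mathbb{R}^2$. Let $\zeta_n=e^{2\pi i/n}$, $\mathbb{K}_n=\mathbb{Q}(\zeta_n)$, $\mathbb{k}_n=\mathbb{Q}(\zeta_n+\bar\zeta_n)$ (the maximal real subfield of $\mathbb{K}_n$), $\mathcal{O}_n=\mathbb{Z}[\zeta_n]$, $\phi$ Euler's totient function, and $N_{\mathbb{k}_n/\mathbb{Q}}$ the field norm. The set $N_2$. For $a\in\mathbb{N}=\{1,2,\dots\}$ let $a^{\downarrow}=\{\frac ab : b\in\mathbb{N},\ b<a,\ \gcd(a,b)=1\}$. For $S\subset\mathbb{R}\setminus\{0\}$ and $\alpha\in\mathbb{Z}$ let $[S]^\alpha=\{x^\alpha : x\in S\}$. Let $N_1=\{\frac43,\frac32,2,3,4\}$, $N=\bigcup_{a\in\{2,3,4,5,6,8,9,12,16\}}\pm a^{\downarrow}$ (i.e. all $x$ and $-x$ with $x\in a^{\downarrow}$), and $N_2=\{-1,1\}\cup[N_1]^2\cup N\cup[N]^{-1}$. Cyclotomic model sets.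 For $n\in\mathbb{N}\setminus\{1,2\}$, choose exactly one automorphism from each pair of complex conjugate automorphisms in $\mathrm{Gal}(\mathbb{K}_n/\mathbb{Q})$, obtaining $\sigma_1=\mathrm{id},\sigma_2,\dots,\sigma_{\phi(n)/2}$. The associated star map $\star:\mathcal{O}_n\to(\mathbb{R}^2)^{\phi(n)/2-1}$ is $z\mapsto(\sigma_2(z),\dots,\sigma_{\phi(n)/2}(z))$. A window is a set $W\subset(\mathbb{R}^2)^{\phi(n)/2-1}$ with $\varnothing\neq W^\circ\subset W\subset\overline{W^\circ}$ and $\overline{W^\circ}$ compact. For a window $W$ and $t\in\mathbb{R}^2$ set $\Lambda_n(t,W)=t+\{z\in\mathcal{O}_n : z^\star\in W\}$. $\mathcal{M}(\mathcal{O}_n)$ is the collection of all sets $\Lambda_n(t,W)$ (all $t$, all windows $W$, all choices of star map); its elements are called cyclotomic model sets. Directions and X-rays. A direction is an element of the unit circle $\mathbb{S}^1$; an $\mathcal{O}_n$-direction is a direction parallel to a non-zero element of $\mathcal{O}_n$. For a finite $F\subset\mathbb{R}^2$ and a direction $u$, the $X$-ray $X_uF$ is the function assigning to each line $\ell$ parallel to $u$ the number $\operatorname{card}(F\cap\ell)$. A collection $\mathcal{E}$ of finite subsets of $\mathbb{R}^2$ is determined by the $X$-rays in the directions of a finite set $U$ of directions if for all $F,F'\in\mathcal{E}$: $(X_uF=X_uF'\ \forall u\in U)\Rightarrow F=F'$. Convex sets. For $S\subset\mathbb{R}^2$, $\mathcal{C}(S)$ is the set of all finite $C\subset S$ with $C=\operatorname{conv}(C)\cap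 S$. Cross ratios. The slope of $u=(x,y)$ is $y/x\in\mathbb{R}\cup\{\infty\}$. The cross ratio of an ordered tuple of four distinct elements of $\mathbb{R}\cup\{\infty\}$ is $(t_1,t_2;t_3,t_4)=\frac{(t_3-t_1)(t_4-t_2)}{(t_3-t_2)(t_4-t_1)}$, with the usual conventions if some $t_i=\infty$. The angle between a direction $u$ and the positive real axis is the unique $\theta\in[0,\pi)$ such that $e^{i\theta}$ is parallel to $u$. The cross ratio of slopes of four pairwise non-parallel $\mathcal{O}_n$-directions always lies in $\mathbb{k}_n$, so the norm is applicable to it. *)

(* Defs.v *)
From HB Require Import structures.
From mathcomp Require Import all_boot all_order all_algebra all_fingroup.
From mathcomp Require Import all_solvable all_field all_character.
From mathcomp Require Import complex finmap.
From mathcomp Require Import all_classical all_reals all_analysis.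
Set Implicit Arguments.
Unset Strict Implicit.
Unset Printing Implicit Defensive.
Import Order.TTheory GRing.Theory Num.Theory.
Import numFieldNormedType.Exports.
Local Open Scope classical_set_scope.
Local Open Scope ring_scope.

Definition plane (R : realType) := (R * R)%type.

Definition toplane (R : realType) (z : R[i]) : plane R :=
  (complex.Re z, complex.Im z).

Definition zetaC (R : realType) (n : nat) : R[i] :=
  (cos (2 * pi / n%:R) +i* sin (2 * pi / n%:R))%C.

(* Q(zeta_n) as an abstract extension of Q, together with its inclusion in C;
   the record is determined up to a unique isomorphism compatible with
   [cf_emb], and [cyclotomic_field_exists] below shows that it is inhabited. *)
Record cyclotomic_field (R : realType) (n : nat) := CyclotomicField {
  cf_field :> splittingFieldType rat;
  cf_emb : {rmorphism cf_field -> R[i]};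
  cf_zeta : cf_field;
  cf_emb_zeta : cf_emb cf_zeta = zetaC R n;
  cf_gen : (<<1; cf_zeta>>)%VS = fullv
}.

Lemma zetaCX (R : realType) (n k : nat) :
  zetaC R n ^+ k =
  (cos (k%:R * (2 * pi / n%:R)) +i* sin (k%:R * (2 * pi / n%:R)))%C.
Proof.
rewrite /zetaC; set x := 2 * pi / n%:R.
elim: k => [|k IHk]; first by rewrite expr0 mul0r cos0 sin0.
rewrite exprS IHk -natr1 mulrDl mul1r [_ + x]addrC cosD sinD.
by apply/eqP; rewrite eq_complex /= !eqxx /= addrC.
Qed.

Lemma zetaC_prim (R : realType) (n : nat) :
  (0 < n)%N -> n.-primitive_root (zetaC R n).
Proof.
move=> n_gt0.
have n0 : n%:R != 0 :> R by rewrite pnatr_eq0 -lt0n.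
have np : 0 < n%:R :> R by rewrite ltr0n.
have z1 : zetaC R n ^+ n = 1.
  rewrite zetaCX mulrC mulfVK // mulr_natl cos2pi sin_mulr2n sinpi mulr0 mul0rn.
  by [].
have [m m_prim m_n] := prim_order_exists n_gt0 z1.
have [mn|nm] := eqVneq m n; first by rewrite -{1}mn.
have m_gt0 := prim_order_gt0 m_prim.
have := dvdn_leq n_gt0 m_n; rewrite leq_eqVlt (negPf nm) => m_lt.
have := prim_expr_order m_prim; rewrite zetaCX => /eqP.
rewrite eq_complex /= => /andP[/eqP c1 _].
have xE : m%:R * (2 * pi / n%:R) = (m%:R * pi / n%:R) *+ 2 :> R.
  by rewrite -[RHS]mulr_natl !mulrA [m%:R * 2]mulrC.
have : 0 < sin (m%:R * pi / n%:R) :> R.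
  apply: sin_gt0_pi; rewrite divr_gt0 ?mulr_gt0 ?pi_gt0 ?ltr0n //=.
  by rewrite ltr_pdivrMr // mulrC ltr_pM2l ?pi_gt0 // ltr_nat.
move: c1; rewrite xE cos_mulr2n cos2sin2 => /eqP.
rewrite subr_eq -mulr2n eqrMn2r //= -[X in _ == X]subr0 (inj_eq (addrI _)).
by rewrite eqr_opp sqrf_eq0 => /eqP ->; rewrite ltxx.
Qed.

Lemma cyclotomic_field_exists (R : realType) (n : nat) :
  (0 < n)%N -> inhabited (cyclotomic_field R n).
Proof.
move=> n_gt0.
have [K _ [_ _ [w [w_prim w_gen] _]]] :=
  group_num_field_exists (Zp n).
have Zn : #|Zp n| = n by rewrite card_Zp.
rewrite Zn in w_prim.
pose i1 : rat -> K := in_alg K.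
have [m mE] : exists m : {poly rat}, minPoly 1 w = map_poly i1 m.
  by have /polyOver1P[m ->] := minPolyOver 1 w; exists m.
have m_size : size m != 1.
  have := size_minPoly 1 w; rewrite mE size_map_poly => ->.
  by [].
pose mC : {poly R[i]} := map_poly ratr m.
have [z /rootP z_root] : exists z, root mC z.
  by apply/closed_rootP; rewrite size_map_poly.
have wd (p : {poly rat}) : (map_poly i1 p).[w] = 0 -> (map_poly ratr p).[z] = 0.
  move=> pw0; have : m %| p.
    rewrite -(dvdp_map i1) -mE minPoly_dvdp ?alg_polyOver //; exact/rootP.
  by move=> /dvdpP[q ->]; rewrite rmorphM hornerM z_root mulr0.
have sur (x : K) : exists p : {poly rat}, (map_poly i1 p).[w] = x.
  have : x \in <<1; w>>%VS by rewrite w_gen memvf.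
  move=> /Fadjoin_poly_eq <-.
  by have /polyOver1P[p ->] := Fadjoin_polyOver 1 w x; exists p.
pose P x := sval (cid (sur x)).
have PE x : (map_poly i1 (P x)).[w] = x by exact: svalP (cid (sur x)).
pose f x := (map_poly ratr (P x)).[z] : R[i].
have fE (p : {poly rat}) : f (map_poly i1 p).[w] = (map_poly ratr p).[z].
  apply/eqP; rewrite -subr_eq0 -hornerN -hornerD -rmorphB; apply/eqP/wd.
  by rewrite rmorphB hornerD hornerN PE subrr.
have f_zmod : zmod_morphism f.
  move=> x y; rewrite -{1}(PE x) -{1}(PE y) -hornerN -hornerD -rmorphB fE.
  by rewrite rmorphB hornerD hornerN.
have f_mon : monoid_morphism f.
  split=> [|x y].
    have -> : 1 = (map_poly i1 1).[w] by rewrite rmorph1 hornerC.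
    by rewrite fE rmorph1 hornerC.
  by rewrite -{1}(PE x) -{1}(PE y) -hornerM -rmorphM fE rmorphM hornerM.
pose Hf := GRing.isZmodMorphism.Build K R[i] f f_zmod.
pose Hm := GRing.isMonoidMorphism.Build K R[i] f f_mon.
pose F : {rmorphism K -> R[i]} := HB.pack f Hf Hm.
have Fw_prim : n.-primitive_root (F w) by rewrite fmorph_primitive_root.
have [j zE] := prim_rootP Fw_prim (prim_expr_order (zetaC_prim R n_gt0)).
have [k wE] := prim_rootP (zetaC_prim R n_gt0) (prim_expr_order Fw_prim).
constructor; apply: (@CyclotomicField R n K F (w ^+ j)).
  by rewrite rmorphXn /= -zE.
apply/eqP; rewrite eqEsubv subvf -w_gen; apply/FadjoinP; split.
  exact: subv_adjoin.
have wjk : w = (w ^+ j) ^+ k.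
  by apply: (fmorph_inj F); rewrite !rmorphXn /= -zE -wE.
have wj : w ^+ j \in <<1; w ^+ j>>%AS by exact: memv_adjoin.
by rewrite [X in X \in _]wjk rpredX.
Qed.

Section ModelSets.
Variables (R : realType) (n : nat) (K : cyclotomic_field R n).

(* On the unit circle zeta^-1 is the complex conjugate of zeta. *)
Definition real_subfield : {subfield K} :=
  <<1; cf_zeta K + (cf_zeta K)^-1>>%AS.

(* [galNorm] is the field norm because real_subfield / Q is Galois. *)
Definition real_norm (x : K) : K := galNorm 1 real_subfield x.

Definition integers : set K :=
  [set x | exists p : {poly int}, x = (map_poly intr p).[cf_zeta K]].

Definition conj_aut (g h : gal_of {: K}) : Prop :=
  forall x : K, cf_emb K (h x) = conjc (cf_emb K (g x)).

(* phi(n) / 2 - 1 *)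
Definition star_dim : nat := ((totient n)./2).-1.

(* The index [ord0] carries sigma_1; the conjugate pair of each automorphism
   contains the value of the family at exactly one index. *)
Definition star_choice (s : 'I_star_dim.+1 -> gal_of {: K}) : Prop :=
  [/\ forall i, s i \in 'Gal({: K} / 1)%g,
      s ord0 = 1%g
    & forall g : gal_of {: K}, g \in 'Gal({: K} / 1)%g ->
        exists! i, s i = g \/ conj_aut g (s i)].

Definition star (s : 'I_star_dim.+1 -> gal_of {: K}) (z : K) :
    'rV[plane R]_star_dim :=
  \row_(j < star_dim) toplane (cf_emb K (s (lift ord0 j) z)).

Definition window (W : set 'rV[plane R]_star_dim) : Prop :=
  [/\ W° !=set0, W° `<=` W, W `<=` closure (W°) & compact (closure (W°))].

Definition model_set (s : 'I_star_dim.+1 -> gal_of {: K}) (t : plane R)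
    (W : set 'rV[plane R]_star_dim) : set (plane R) :=
  [set t + toplane (cf_emb K z) | z in [set z | integers z /\ W (star s z)]].

Definition cyclotomic_model_sets : set (set (plane R)) :=
  [set L | exists s t W, [/\ star_choice s, window W & L = model_set s t W]].

End ModelSets.

Section Tomography.
Variable R : realType.
Implicit Types (u v : plane R) (F S : set (plane R)).

Definition unit_circle : set (plane R) := [set u | u.1 ^+ 2 + u.2 ^+ 2 = 1].

Definition parallel u v : Prop := exists2 k : R, k != 0 & v = k *: u.

Definition integer_directions (n : nat) (K : cyclotomic_field R n) :
    set (plane R) :=
  unit_circle `&`
  [set u | exists z : K,
     [/\ integers z, z != 0 & parallel u (toplane (cf_emb K z))]].

Definition parallel_lines u : set (set (plane R)) :=
  [set l | exists p, l = [set p + k *: u | k in [set: R]]].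

Definition xray u F (l : {l | parallel_lines u l}) : nat :=
  #|` fset_set (F `&` sval l)|%fset.
Arguments xray u F l : clear implicits.

Definition determined_by_xrays (E : set (set (plane R))) (U : set (plane R)) :
    Prop :=
  forall F F', E F -> E F' -> (forall u, U u -> xray u F =1 xray u F') -> F = F'.

Definition convex_hull F : set (plane R) :=
  smallest (@convex_set R (plane R)) F.

Definition convex_subsets S : set (set (plane R)) :=
  [set C | [/\ finite_set C, C `<=` S & C = convex_hull C `&` S]].

(* [None] is the slope at infinity. *)
Definition slope u : option R :=
  if u.1 == 0 then None else Some (u.2 / u.1).

(* The last branch is never reached on four distinct arguments. *)
Definition cross_ratio (t1 t2 t3 t4 : option R) : R :=
  match t1, t2, t3, t4 with
  | Some t1, Some t2, Some t3, Some t4 =>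
      ((t3 - t1) * (t4 - t2)) / ((t3 - t2) * (t4 - t1))
  | None, Some t2, Some t3, Some t4 => (t4 - t2) / (t3 - t2)
  | Some t1, None, Some t3, Some t4 => (t3 - t1) / (t4 - t1)
  | Some t1, Some t2, None, Some t4 => (t4 - t2) / (t4 - t1)
  | Some t1, Some t2, Some t3, None => (t3 - t1) / (t3 - t2)
  | _, _, _, _ => 0
  end.

Definition angle u : R :=
  xget 0 [set a : R | 0 <= a < pi /\ parallel (cos a, sin a) u].

End Tomography.

(* N_2 is taken in [rat]: all its elements are rational. *)

Definition down (a : nat) : set rat :=
  [set x | exists b : nat,
     [/\ (0 < b)%N, (b < a)%N, coprime a b & x = a%:R / b%:R]].

Definition pow_set (S : set rat) (e : int) : set rat := [set x ^ e | x in S].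

Definition N1 : set rat := [set 4 / 3; 3 / 2; 2; 3; 4].

Definition N : set rat :=
  \bigcup_(a in [set` [:: 2; 3; 4; 5; 6; 8; 9; 12; 16]%N])
    (down a `|` [set - x | x in down a]).

Definition N2 : set rat :=
  [set -1; 1] `|` pow_set N1 2 `|` N `|` pow_set N (-1).

(* Main.v *)
Require Import Defs.
From HB Require Import structures.
From mathcomp Require Import all_boot all_order all_algebra all_fingroup.
From mathcomp Require Import all_solvable all_field all_character.
From mathcomp Require Import complex finmap.
From mathcomp Require Import all_classical all_reals all_analysis.
From mathcomp Require Import zify ring lra.
Set Implicit Arguments.
Unset Strict Implicit.
Unset Printing Implicit Defensive.
Import Order.TTheory GRing.Theory Num.Theory.
Import numFieldNormedType.Exports.
Local Open Scope classical_set_scope.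
Local Open Scope ring_scope.


(** Suppose that two different convex subsets F and F' of a model set have the
    same X-rays in four pairwise non-parallel directions.  The proof shows that
    the cross ratio of the slopes is then a cross ratio of four distinct roots
    of unity, and that the norm of such a number, when it lies in a real
    quadratic field, is in N_2.

    The geometric half.  Let A = F \ F' and B = F' \ F.  Equality of the X-rays
    pairs, for each direction u, the points of A with those of B on the same
    lines parallel to u; hence A and B have the same centroid o, which lies in
    both convex hulls.  By convexity no point of one set lies in the convex
    hull of o and two points of the other one ([unmixed]).  In particular
    every ray from o meets at most one of the two sets, so around o the points
    fall into m successive clusters that belong alternately to A and to B.
    Seen along u, a line that meets A or B has all its points of one set to the
    left of those of the other; following these lines from top to bottom, the
    convexity condition forces the clusters to be met symmetrically on both
    sides.  So the pairing along u acts on the cyclic indices of the clusters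
    as a reflection i |-> c_u - i ([labelling_exists], [labelling_unique]).

    Let T in C^2 be the sum over all points v of e^(2 i pi k(v) / m) (v - o),
    where k(v) is the index of the cluster of v.  The reflection property says
    that det(u, T) = w_u det(u, conj T), with w_u = e^(2 i pi c_u / m).  A sign
    change argument in the style of Sturm and Hurwitz
    ([moments_nondegenerate]) shows that T and conj T are linearly independent,
    so that w_u |-> slope of u is a homography, and it preserves cross ratios
    ([cross_products_roots_of_unity]).  Geometrically, T spans an affinely
    regular polygon with m vertices that has u among the directions of its
    chords, the one which Darboux's process of iterated midpoint polygons
    approaches.

    The arithmetic half.  A cross ratio of roots of unity is a quotient of
    products of two factors 1 - w.  If w has order d, then the norm of 1 - w
    over Q is a power of Phi_d(1), which is p when d is a power of a prime p
    and is 1 up to sign otherwise.  If q is the norm of the cross ratio from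
    the real quadratic field, comparison of norms shows that each factor 1 - w
    contributes at most 2 / (p - 1) to the exponent of its prime p in q.  With
    two factors above and two below, the numerator and the denominator of q
    each divide 16, 9, 5 or 12 ([cross_ratio_norm_bound]); this is the list that
    defines N_2. *)

(** * Values of cyclotomic polynomials at 1 *)

Local Notation Phi1 d := ('Phi_d).[1].

Lemma prod_Phi1 n : (0 < n)%N ->
  \prod_(d <- divisors n | d != 1%N) Phi1 d = n%:R :> int.
Proof.
move=> n_gt0; have Xn := prod_Cyclotomic n_gt0.
have P1 : 'Phi_1 = 'X - 1 :> {poly int}.
  by have := prod_Cyclotomic (ltn0Sn 0); rewrite big_seq1 expr1.
move: Xn; rewrite (bigD1_seq 1%N) ?divisors_id ?divisors_uniq //=; last by rewrite -dvdn_divisors.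
rewrite P1 subrX1 -polyC1 => /mulfI; rewrite polyXsubC_eq0 => /(_ isT).
move=> /(congr1 (horner^~ 1)); rewrite horner_prod horner_sum => ->.
by rewrite (eq_bigr (fun=> 1)) ?sumr_const ?card_ord // => i _; rewrite hornerXn expr1n.
Qed.


Lemma Phi1_pfactor p k : prime p -> Phi1 (p ^ k.+1) = p%:R :> int.
Proof.
move=> p_pr; have pk_gt0 j : (0 < p ^ j)%N by rewrite expn_gt0 prime_gt0.
have := prod_Phi1 (pk_gt0 k.+1).
rewrite -big_filter (bigD1_seq (p ^ k.+1)%N) ?filter_uniq ?divisors_uniq //=; last first.
  by rewrite mem_filter divisors_id // -[1%N](expn0 p) eqn_exp2l ?prime_gt1.
rewrite big_filter_cond expnS natrM -(prod_Phi1 (pk_gt0 k)) -big_filter -[in RHS]big_filter.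
rewrite (perm_big [seq d <- divisors (p ^ k) | d != 1%N]) => [/mulIf -> //|].
  rewrite big_filter prod_Phi1 // pnatr_eq0 -lt0n //.
apply: uniq_perm; rewrite ?filter_uniq ?divisors_uniq // => d.
rewrite !mem_filter -!dvdn_divisors // -?expnS //.
have p1 := prime_gt1 p_pr.
apply/andP/andP => [[/andP[-> d_pk]] | [d1 d_pk]].
  move=> /(dvdn_pfactor _ _ p_pr)[j j_k dE]; split=> //; move: d_pk.
  by rewrite dE eqn_exp2l // dvdn_Pexp2l // => jk; rewrite -ltnS ltn_neqAle jk.
rewrite d1; split; last by apply: dvdn_trans d_pk _; rewrite dvdn_exp2l.
apply: contraTneq d_pk => ->; rewrite dvdn_Pexp2l // -ltnNge //.
Qed.

(** The divisors d > 1 of a and of b already contribute a * b to the product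
    of all Phi_d(1) with d | a * b, so that the remaining integers Phi_d(1),
    among which d = a * b, have product 1. *)
Lemma Phi1_coprime_mul a b : (1 < a)%N -> (1 < b)%N -> coprime a b ->
  `|Phi1 (a * b)|%N = 1%N.
Proof.
move=> a1 b1 co_ab; have [a0 b0] := (ltnW a1, ltnW b1).
have ab0 : (0 < a * b)%N by rewrite muln_gt0 a0.
have sub c : (0 < c)%N -> (c %| a * b)%N ->
    \prod_(d <- divisors (a * b) | (d != 1%N) && (d %| c)%N) Phi1 d = c%:R :> int.
  move=> c0 c_ab; rewrite -prod_Phi1 // -big_filter -[in RHS]big_filter.
  apply: perm_big; apply: uniq_perm; rewrite ?filter_uniq ?divisors_uniq // => e.
  rewrite !mem_filter -!dvdn_divisors // -andbA; congr (_ && _).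
  by apply/andP/idP => [[]//|e_c]; split=> //; apply: dvdn_trans c_ab.
have := prod_Phi1 ab0; rewrite (bigID (dvdn^~ a)) /= sub ?dvdn_mulr // natrM.
move=> /mulfI; rewrite pnatr_eq0 -lt0n => /(_ a0); rewrite (bigID (dvdn^~ b)) /=.
rewrite [X in X * _](_ : _ = b%:R) => [|]; last first.
  rewrite -(sub b) ?dvdn_mull //; apply: eq_bigl => d.
  case d1: (d == 1%N) => //=; case d_b: (d %| b)%N; rewrite ?andbF // !andbT.
  apply/negP => d_a; move: d1; rewrite -dvdn1 -(eqP co_ab) dvdn_gcd d_a d_b //.
rewrite -[RHS]mulr1 => /mulfI; rewrite pnatr_eq0 -lt0n => /(_ b0).
rewrite -big_filter (bigD1_seq (a * b)%N) ?filter_uniq ?divisors_uniq //=.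
  by move=> /(congr1 absz); rewrite abszM => /eqP; rewrite muln_eq1 => /andP[/eqP].
rewrite mem_filter divisors_id // andbT; apply/andP; split; [apply/andP; split|].
- by rewrite neq_ltn (leq_trans a1) ?orbT // leq_pmulr.
- by rewrite gtnNdvd // ltn_Pmulr.
- by rewrite gtnNdvd // ltn_Pmull.
Qed.

(** The bound p - 1 <= phi(d) limits the contribution of the prime p to the
    norm of 1 - w, for w of order d, in proportion to the degree. *)
Lemma Phi1_cases d : (1 < d)%N ->
  `|Phi1 d|%N = 1%N \/ prime `|Phi1 d|%N /\ (`|Phi1 d|%N.-1 <= totient d)%N.
Proof.
move=> d1; have d0 := ltnW d1; pose p := pdiv d.
have p_pr : prime p by rewrite pdiv_prime.
have p_d : (p %| d)%N by rewrite pdiv_dvd.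
have l0 : (0 < logn p d)%N by rewrite logn_gt0 mem_primes p_pr d0.
have := pfactor_coprime p_pr d0 => -[m co_pm dE].
have [m1|m1] := eqVneq m 1%N.
  right; rewrite dE m1 mul1n; case: (logn p d) l0 => // k _.
  rewrite Phi1_pfactor //= natz absz_nat; split=> //.
  by rewrite totient_pfactor // leq_pmulr // expn_gt0 prime_gt0.
left; rewrite dE; apply: Phi1_coprime_mul.
- case: m m1 dE {co_pm} => [|[|]] // _; lia.
- by rewrite -[X in (X < _)%N](expn0 p) ltn_exp2l // prime_gt1.
- by rewrite coprime_sym coprime_pexpl.
Qed.

Lemma dvdn_logn a b : (0 < a)%N -> (0 < b)%N ->
  (forall p, prime p -> (logn p a <= logn p b)%N) -> (a %| b)%N.
Proof.
move=> a0 b0 le_ab; apply/dvdn_partP => // p p_a.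
have p_pr : prime p by move: p_a; rewrite mem_primes => /andP[].
by rewrite p_part pfactor_dvdn // le_ab.
Qed.

(** The possible numerators and denominators of norms: 16, 9 and 5 come from
    two factors 1 - w at the same prime 2, 3 or 5, and 12 = 4 * 3 from two
    factors at different primes. *)
Definition small_norm_part a := [|| a %| 16, a %| 9, a %| 5 | a %| 12]%N.

(** Here a is the numerator of a norm, c1 and c2 are the values Phi_d(1) of
    the two factors, f1 and f2 the totients of their orders, and E clears the
    denominators of the exponents 2 / f1 and 2 / f2.  Comparing the exponents
    of p gives (p - 1) v_p(a) <= 2 [c1 = p] + 2 [c2 = p]. *)
Lemma dvdn_prime_powers a E c1 c2 t1 t2 f1 f2 :
  (0 < a)%N -> (0 < E)%N -> (t1 * f1 = E)%N -> (t2 * f2 = E)%N ->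
  c1 = 1%N \/ prime c1 /\ (c1.-1 <= f1)%N ->
  c2 = 1%N \/ prime c2 /\ (c2.-1 <= f2)%N ->
  (a ^ E %| c1 ^ (2 * t1) * c2 ^ (2 * t2))%N ->
  small_norm_part a.
Proof.
move=> a0 E0 tf1 tf2 c1P c2P a_c.
have c10 : (0 < c1)%N by case: c1P => [->|[/prime_gt0]].
have c20 : (0 < c2)%N by case: c2P => [->|[/prime_gt0]].
have log c t f p : prime p -> (t * f = E)%N -> c = 1%N \/ prime c /\ (c.-1 <= f)%N ->
    (p.-1 * logn p (c ^ (2 * t)) <= 2 * E * (c == p))%N.
  move=> p_pr tfE [->|[c_pr c_f]]; first by rewrite exp1n logn1 muln0.
  rewrite lognX logn_prime // [p == c]eq_sym; have [cp|_] := eqVneq c p; last by rewrite !muln0.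
  by rewrite -cp !muln1 mulnCA leq_mul2l /= [(c.-1 * t)%N]mulnC -tfE leq_mul2l c_f orbT.
have L p : prime p -> (p.-1 * logn p a <= 2 * (c1 == p) + 2 * (c2 == p))%N.
  move=> p_pr; have := dvdn_leq_log p _ a_c; rewrite muln_gt0 !expn_gt0 c10 c20.
  move=> /(_ isT); rewrite lognM ?expn_gt0 ?c10 ?c20 // lognX.
  have := log _ _ _ p p_pr tf1 c1P; have := log _ _ _ p p_pr tf2 c2P.
  move: (logn p _) (logn p _) (logn p _) => l1 l2 l3 H1 H2 H3.
  rewrite -(leq_pmul2l E0) mulnCA (leq_trans (leq_mul (leqnn _) H3)) //.
  by rewrite mulnDr mulnDr !mulnA ![(E * 2)%N]mulnC leq_add.
have div b : (0 < b)%N -> (logn 2 a <= logn 2 b)%N -> (logn 3 a <= logn 3 b)%N ->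
    (logn 5 a <= logn 5 b)%N -> (a %| b)%N.
  move=> b0 l2 l3 l5; apply: dvdn_logn => // p p_pr.
  have [->//|p2] := eqVneq p 2; have [->//|p3] := eqVneq p 3.
  have [->//|p5] := eqVneq p 5; have := L p p_pr.
  have p6 : (6 <= p)%N by case: p p_pr p2 p3 p5 => [|[|[|[|[|[|]]]]]].
  case: (logn p a) => // l; have := leq_pmulr p.-1 (ltn0Sn l).
  by move: (p.-1 * _)%N => k; case: (c1 == p); case: (c2 == p); lia.
have := (L 2 isT, L 3 isT, L 5 isT) => -[[]] /=.
move: (logn 2 a) (logn 3 a) (logn 5 a) div => l2 l3 l5 div.
have lE : ((logn 2 16 = 4)%N * (logn 3 9 = 2)%N * (logn 5 5 = 1)%N *
    (logn 2 12 = 2)%N * (logn 3 12 = 1)%N)%type by [].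
rewrite mul1n => L2 L3 L5.
have [c12|c12] := eqVneq c1 c2; last first.
  apply/or4P/Or44/div; rewrite ?lE //.
  - by move: L2 c12; case: (c1 =P 2%N) => [->|_]; case: (c2 =P 2%N) => [->|_] //=; lia.
  - by move: L3 c12; case: (c1 =P 3%N) => [->|_]; case: (c2 =P 3%N) => [->|_] //=; lia.
  - by move: L5 c12; case: (c1 =P 5%N) => [->|_]; case: (c2 =P 5%N) => [->|_] //=; lia.
rewrite {}c12 in L2 L3 L5.
have [c2E|n2] := eqVneq c2 2%N.
  by apply/or4P/Or41/div; rewrite ?lE //; rewrite c2E /= in L2 L3 L5; lia.
have [c2E|n3] := eqVneq c2 3%N.
  by apply/or4P/Or42/div; rewrite ?lE //; rewrite c2E /= in L2 L3 L5; lia.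
apply/or4P/Or43/div; rewrite ?lE //.
- by rewrite (negPf n2) in L2; lia.
- by rewrite (negPf n3) in L3; lia.
- by case: (c2 =P 5%N) L5 => _; lia.
Qed.

(** * Norms of cross ratios of roots of unity *)

Lemma galois_rat (L : splittingFieldType rat) : galois 1 {:L}.
Proof.
rewrite /galois sub1v normalFieldf andbT; apply/separableP => x _.
apply: pcharf0_separable => p; rewrite (pchar_lalg L) pchar_num //.
Qed.

Lemma map_Cyclotomic (F : fieldType) n (z : F) :
  n.-primitive_root z -> map_poly intr 'Phi_n = cyclotomic z n.
Proof.
elim/ltn_ind: n z => n IHn z prim_z; have n_gt0 := prim_order_gt0 prim_z.
have := prod_cyclotomic prim_z; have := prod_Cyclotomic n_gt0.
move=> /(congr1 (map_poly (intr : int -> F))).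
rewrite rmorph_prod rmorphB rmorph1 /= map_polyXn => <-.
rewrite !(bigD1_seq n) ?divisors_id ?divisors_uniq //= divnn n_gt0 expr1.
rewrite [X in _ * X = _](_ : _ = \prod_(d <- divisors n | d != n) cyclotomic (z ^+ (n %/ d)) d).
  apply: mulIf; apply/monic_neq0/monic_prod => d _; exact: cyclotomic_monic.
rewrite big_seq_cond [RHS]big_seq_cond; apply: eq_bigr => d /andP[].
rewrite -dvdn_divisors // => d_n dn; apply: IHn; last exact: dvdn_prim_root.
by rewrite ltn_neqAle dn dvdn_leq.
Qed.

Section Norms.
Variable L : splittingFieldType rat.
Implicit Types w : L.

(** Irreducibility of cyclotomic polynomials over Q, transferred from the
    algebraic complex numbers: a common root of Phi_d and of the minimal
    polynomial of w is a primitive d-th root there, and Phi_d is its minimal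
    polynomial. *)
Lemma minPoly_prim_root d w w' :
  d.-primitive_root w -> d.-primitive_root w' -> root (minPoly 1 w) w'.
Proof.
move=> prim_w prim_w'; have d_gt0 := prim_order_gt0 prim_w.
have [m mE] : exists m : {poly rat}, minPoly 1 w = map_poly (in_alg L) m.
  by have /polyOver1P[m ->] := minPolyOver 1 w; exists m.
pose f : {poly rat} := map_poly intr 'Phi_d.
have fE (F : fieldType) (g : {rmorphism rat -> F}) (v : F) : d.-primitive_root v ->
    map_poly g f = cyclotomic v d.
  move=> /map_Cyclotomic <-; rewrite -map_poly_comp; apply: eq_map_poly => x /=.
  by rewrite rmorph_int.
have fL := fE _ (in_alg L) _ prim_w.
have fC (z : algC) : d.-primitive_root z -> map_poly ratr f = cyclotomic z d by exact: fE.
have f0 : f != 0.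
  rewrite -(map_poly_eq0 (in_alg L)) fL monic_neq0 //.
  exact: cyclotomic_monic.
pose g := gcdp f m.
have gw : root (map_poly (in_alg L) g) w.
  rewrite gcdp_map root_gcd fL root_cyclotomic // prim_w -mE.
  exact: root_minPoly.
have /closed_rootP[z gz] : size (map_poly (ratr : rat -> algC) g) != 1.
  rewrite size_map_poly -(size_map_poly (in_alg L)); apply: contraTneq gw.
  by move=> /eqP/size_poly1P[c c0 ->]; rewrite rootC.
have [v prim_v] := C_prim_root_exists d_gt0.
have [fz mz] : root (map_poly (ratr : rat -> algC) f) z /\
    root (map_poly (ratr : rat -> algC) m) z.
  by apply/andP; rewrite -root_gcd -gcdp_map.
have prim_z : d.-primitive_root z by rewrite -(root_cyclotomic prim_v) -(fC _ prim_v).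
have [p [pE _] pP] := minCpolyP z.
have : f %| m.
  rewrite -(_ : p = f) -?pP //; apply: (map_poly_inj (ratr : {rmorphism rat -> algC})).
  by rewrite -pE (fC _ prim_z) (minCpoly_cyclotomic prim_z).
rewrite -(dvdp_map (in_alg L)) -mE fL => /dvdpP[h ->].
by rewrite rootM root_cyclotomic // prim_w' orbT.
Qed.

(** All the phi(d) factors of Phi_d(1), the product of 1 - w ^ k over k prime
    to d, are conjugate, hence have the same norm. *)
Lemma galNorm_one_sub d w : d.-primitive_root w ->
  galNorm 1 {:L} (1 - w) ^+ totient d = (Phi1 d)%:~R ^+ #|'Gal({:L} / 1)%g|.
Proof.
move=> prim_w.
have cE : (Phi1 d)%:~R = \prod_(k < d | coprime k d) (1 - w ^+ k).
  transitivity (map_poly (intr : int -> L) 'Phi_d).[1].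
    by have := horner_map (intr : {rmorphism int -> L}) 'Phi_d 1; rewrite rmorph1.
  rewrite (map_Cyclotomic prim_w) horner_prod; apply: eq_bigr => k _.
  by rewrite hornerXsubC.
transitivity (galNorm 1 {:L} (Phi1 d)%:~R); last first.
  rewrite /galNorm -prodr_const; apply: eq_bigr => g _; exact: rmorph_int.
rewrite cE galNorm_prod (eq_bigr (fun=> galNorm 1 {:L} (1 - w))) => [|k co_kd].
  rewrite prodr_const; congr (_ ^+ _); rewrite totient_count_coprime.
  by rewrite -big_mkcond big_mkord -sum1_card; apply: eq_bigl => k; rewrite coprime_sym.
have prim_wk : d.-primitive_root (w ^+ k) by rewrite prim_root_exp_coprime.
have [g Gg gw] := normalField_root_minPoly (sub1v _) (normalFieldf 1) (memvf w)
  (minPoly_prim_root prim_w prim_wk).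
by rewrite -(galNorm_gal (memvf (1 - w)) Gg) rmorphB rmorph1 /= gw.
Qed.

(** If y is irrational, some automorphism maps y to the other root q / y of
    its quadratic equation, so that y and q / y have the same norm. *)
Lemma galNorm_quadratic (y s q : L) : s \in 1%VS -> q \in 1%VS ->
  y ^+ 2 - s * y + q = 0 -> (y \in 1%VS -> q = y ^+ 2) ->
  galNorm 1 {:L} y ^+ 2 = q ^+ #|'Gal({:L} / 1)%g|.
Proof.
move=> s1 q1 yE y1.
have fix1 g v : v \in 1%VS -> g \in 'Gal({:L} / 1)%g -> g v = v.
  by move=> v1 Gg; apply: (fixed_gal (sub1v _)).
have qN : galNorm 1 {:L} q = q ^+ #|'Gal({:L} / 1)%g|.
  by rewrite /galNorm -prodr_const; apply: eq_bigr => g Gg; rewrite fix1.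
rewrite -qN; have [Y1|Y1] := boolP (y \in 1%VS); first by rewrite (y1 Y1) galNormX.
have [g Gg gy] : exists2 g, g \in 'Gal({:L} / 1)%g & g y != y.
  apply/exists_inP; rewrite -negb_forall_in; apply: contra Y1 => /forall_inP yfix.
  have /galois_fixedField <- := galois_rat L.
  by apply/fixedFieldP => [|g Gg]; [exact: memvf|exact/eqP/yfix].
rewrite expr2 -[X in _ * X](galNorm_gal (memvf y) Gg) -galNormM; congr (galNorm _ _ _).
have := congr1 g yE; rewrite rmorph0 rmorphD rmorphB rmorphXn rmorphM /= (fix1 g s) // (fix1 g
  q) // => gyE.
have sE : (g y - y) * (g y + y - s) = 0.
  by rewrite -[RHS](subrr 0) -{1}gyE -yE; ring.
have /eqP := sE; rewrite mulf_eq0 subr_eq0 (negPf gy) subr_eq0 /= => /eqP sE'.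
by apply/eqP; rewrite -subr_eq0 -oppr_eq0 -yE -sE'; apply/eqP; ring.
Qed.

(** The number q is the norm of y from a quadratic field.  By
    [galNorm_quadratic] it satisfies q ^ [L : Q] = N(y) ^ 2, where powers of
    N(y) are known from [galNorm_one_sub]. *)
Lemma cross_ratio_norm_bound (m : nat) (a1 a2 a3 a4 y : L) (s q : rat) :
  (0 < m)%N -> a1 ^+ m = 1 -> a2 ^+ m = 1 -> a3 ^+ m = 1 -> a4 ^+ m = 1 ->
  a1 != 1 -> a2 != 1 -> a3 != 1 -> a4 != 1 ->
  y * ((1 - a3) * (1 - a4)) = (1 - a1) * (1 - a2) ->
  y ^+ 2 - s%:A * y + q%:A = 0 -> (y \in 1%VS -> q%:A = y ^+ 2) ->
  small_norm_part `|numq q|%N && small_norm_part `|denq q|%N.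
Proof.
move=> m_gt0 a1m a2m a3m a4m a11 a21 a31 a41 yE yq y1.
pose G := #|'Gal({:L} / 1)%g|.
have G_gt0 : (0 < G)%N by exact: cardG_gt0.
have data (a : L) : a ^+ m = 1 -> a != 1 -> exists (r : rat) (c f : nat),
    [/\ galNorm 1 {:L} (1 - a) ^+ f = r%:A ^+ G, (0 < f)%N, `|r| = c%:R
      & c = 1%N \/ prime c /\ (c.-1 <= f)%N].
  move=> am an1; have [d prim_a _] := prim_order_exists m_gt0 am.
  have d1 : (1 < d)%N.
    case: d prim_a (prim_order_gt0 prim_a) => [|[|//]] // prim_a _.
    by move: an1; rewrite -[a]expr1 (prim_expr_order prim_a) eqxx.
  exists (Phi1 d)%:~R, `|Phi1 d|%N, (totient d); split.
  - by rewrite galNorm_one_sub // scaler_int.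
  - by rewrite totient_gt0 ltnW.
  - by rewrite -intr_norm -abszE.
  - exact: Phi1_cases.
have [r1 [c1 [f1 [N1 f1_gt0 rc1 c1P]]]] := data a1 a1m a11.
have [r2 [c2 [f2 [N2 f2_gt0 rc2 c2P]]]] := data a2 a2m a21.
have [r3 [c3 [f3 [N3 f3_gt0 rc3 c3P]]]] := data a3 a3m a31.
have [r4 [c4 [f4 [N4 f4_gt0 rc4 c4P]]]] := data a4 a4m a41.
have rat1 (r : rat) : r%:A \in (1%VS : {vspace L}).
  by rewrite rpredZ // mem1v.
have Nq := galNorm_quadratic (rat1 s) (rat1 q) yq y1.
pose E := (f1 * f2 * f3 * f4)%N.
have E_gt0 : (0 < E)%N by rewrite !muln_gt0 f1_gt0 f2_gt0 f3_gt0.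
pose t1 := (f2 * f3 * f4)%N; pose t2 := (f1 * f3 * f4)%N.
pose t3 := (f1 * f2 * f4)%N; pose t4 := (f1 * f2 * f3)%N.
have tf1 : (t1 * f1 = E)%N by rewrite /t1 /E; lia.
have tf2 : (t2 * f2 = E)%N by rewrite /t2 /E; lia.
have tf3 : (t3 * f3 = E)%N by rewrite /t3 /E; lia.
have tf4 : (t4 * f4 = E)%N by rewrite /t4 /E; lia.
have NE a r f t : (t * f = E)%N -> galNorm 1 {:L} (1 - a) ^+ f = r%:A ^+ G ->
    galNorm 1 {:L} (1 - a) ^+ (2 * E) = (r ^+ (2 * t) ^+ G)%:A.
  move=> tfE NaE; rewrite -tfE mulnA mulnC exprM NaE exprAC.
  by rewrite -[RHS]/(in_alg L _) !rmorphXn.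
(* E is a multiple of the four totients, so all norms become rational powers *)
have key : (q ^+ E * (r3 ^+ (2 * t3) * r4 ^+ (2 * t4))) ^+ G
   = (r1 ^+ (2 * t1) * r2 ^+ (2 * t2)) ^+ G.
  apply: (fmorph_inj (in_alg L)).
  rewrite !exprMn 3!rmorphM /= -(NE a1 _ _ _ tf1 N1) -(NE a2 _ _ _ tf2 N2).
  rewrite -(NE a3 _ _ _ tf3 N3) -(NE a4 _ _ _ tf4 N4).
  rewrite [q ^+ E ^+ G]exprAC -[X in X * _ = _]/(in_alg L _) 2!rmorphXn /= -Nq -exprM -!exprMn.
  by rewrite -!galNormM yE.
have keyR : `|q| ^+ E * (c3%:R ^+ (2 * t3) * c4%:R ^+ (2 * t4))
   = c1%:R ^+ (2 * t1) * c2%:R ^+ (2 * t2).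
  have := congr1 Num.norm key; rewrite [LHS]normrX [RHS]normrX => /eqP.
  by rewrite eqrXn2 // => /eqP; rewrite !normrM !normrX rc1 rc2 rc3 rc4.
have keyN : (`|numq q| ^ E * (c3 ^ (2 * t3) * c4 ^ (2 * t4)) =
    `|denq q| ^ E * (c1 ^ (2 * t1) * c2 ^ (2 * t2)))%N.
  apply/eqP; rewrite -(eqr_nat rat) !natrM !natrX -keyR; apply/eqP; rewrite [RHS]mulrA -exprMn.
  congr (_ ^+ _ * _); rewrite -[q in `|q|]divq_num_den normrM normfV.
  by rewrite !natr_absz !intr_norm mulrCA mulfV ?mulr1 // normr_eq0 intr_eq0 denq_neq0.
have co := coprime_num_den q.
have c_gt0 c f : c = 1%N \/ prime c /\ (c.-1 <= f)%N -> (0 < c)%N.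
  by case=> [->|[/prime_gt0]].
apply/andP; split.
  apply: (dvdn_prime_powers _ E_gt0 tf1 tf2 c1P c2P).
    rewrite lt0n; apply/eqP => q0; move: keyN; rewrite q0 (exp0n E_gt0) mul0n => /esym/eqP.
    by rewrite !muln_eq0 !expn_eq0 absz_eq0 denq_eq0 eqn0Ngt (c_gt0 _ _ c1P) eqn0Ngt (c_gt0 _ _
      c2P).
  by rewrite -(Gauss_dvdr _ (coprimeXl E (coprimeXr E co))) -keyN dvdn_mulr.
apply: (dvdn_prime_powers _ E_gt0 tf3 tf4 c3P c4P); first by rewrite absz_gt0 denq_eq0.
rewrite coprime_sym in co.
by rewrite -(Gauss_dvdr _ (coprimeXl E (coprimeXr E co))) keyN dvdn_mulr.
Qed.
End Norms.

(** * The real quadratic subfields *)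

Lemma rat_sqr_neq_prime (r : rat) (p : nat) : prime p -> r ^+ 2 != p%:R.
Proof.
move=> p_pr; apply/eqP => rE.
have num0 : numq r != 0.
  apply: contraTneq p_pr => r0; move/eqP: rE.
  by rewrite -[r]divq_num_den r0 mul0r expr0n eq_sym pnatr_eq0 => /eqP ->.
have : (`|numq r| ^ 2 = p * `|denq r| ^ 2)%N.
  apply/eqP; rewrite -(eqr_nat rat) natrM !natrX !natr_absz !intr_norm !real_normK ?realz //.
  by rewrite -rE -exprMn -[r in r * _]divq_num_den mulfVK ?intr_eq0 ?denq_neq0.
move=> /(congr1 (logn p)); rewrite lognM ?(prime_gt0 p_pr) ?expn_gt0 ?absz_gt0 ?denq_eq0 //.
by rewrite !lognX (logn_prime p p_pr) eqxx => /(congr1 odd); rewrite oddD !oddM.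
Qed.

Section Quadratic.
Variable L : splittingFieldType rat.
Implicit Types x h : L.

Lemma quadratic_galois h (b c : rat) : h \notin 1%VS -> h ^+ 2 = b%:A * h + c%:A ->
  galois 1 <<1; h>> /\ #|'Gal(<<1; h>> / 1)%g| = 2.
Proof.
move=> h1 hE; pose h' := b%:A - h; pose p : {poly L} := ('X - h%:P) * ('X - h'%:P).
have A1 (r : rat) : r%:A \in (1%VS : {vspace L}) by rewrite rpredZ // mem1v.
have pE : p = 'X^2 - b%:A%:P * 'X - c%:A%:P.
  have -> : c%:A%:P = h%:P * (h%:P - b%:A%:P) :> {poly L}.
    by rewrite -polyCB -polyCM mulrBr -expr2 hE; congr (_%:P); ring.
  by rewrite /p /h' polyCB; ring.
have p1 : p \is a polyOver 1%VS.
  by rewrite pE !rpredB ?rpredM ?polyOverXn ?polyOverC ?polyOverX //= A1.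
have gal1 : galois 1 <<1; h>>.
  apply/splitting_galoisField; exists p; split=> //.
    have -> : p = \prod_(r <- [:: h; h']) ('X - r%:P) by rewrite !big_cons big_nil mulr1.
    rewrite separable_prod_XsubC /= inE andbT; apply: contraNneq h1 => hh'.
    have -> : h = (b / 2)%:A.
      apply: (mulIf (_ : 2%:R != 0 :> L)).
        by rewrite -(rmorph_nat (in_alg L)) fmorph_eq0.
      rewrite -(rmorph_nat (in_alg L)) -(rmorphM (in_alg L)) divfK //=.
      by rewrite scaler_nat mulr2n mulrDr mulr1 {2}hh' /h'; ring.
    exact: A1.
  exists [:: h; h']; first by rewrite !big_cons big_nil mulr1 eqpxx.
  rewrite adjoin_cons adjoin_seq1; apply/Fadjoin_idP.
  by rewrite rpredB ?memv_adjoin // (subvP (subv_adjoin _ _)) // A1.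
split=> //; rewrite -(galois_dim gal1) -adjoin_degreeE.
have d_gt0 : (0 < adjoin_degree 1 h)%N by [].
have d_neq1 : adjoin_degree 1 h != 1%N by rewrite adjoin_deg_eq1.
have : (size (minPoly 1 h) <= 3)%N.
  rewrite (leq_trans (dvdp_leq _ (minPoly_dvdp p1 _))) //.
  - by rewrite mulf_neq0 // polyXsubC_eq0.
  - by rewrite /p rootM root_XsubC eqxx.
  - by rewrite size_Mmonic ?polyXsubC_eq0 ?monicXsubC // !size_XsubC.
by rewrite size_minPoly; case: (adjoin_degree 1 h) d_gt0 d_neq1 => [|[|[|]]].
Qed.

(** With g the non-trivial automorphism, s and q are x + g x and x * g x. *)
Lemma galNorm_order2 (E : {subfield L}) x : galois 1 E -> #|'Gal(E / 1)%g| = 2 ->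
  x \in E -> exists s q : rat,
    [/\ galNorm 1 E x = q%:A, x ^+ 2 - s%:A * x + q%:A = 0
      & x \in 1%VS -> q%:A = x ^+ 2].
Proof.
move=> gal1 G2 xE.
have [s sE] := vlineP _ _ (mem_galTrace gal1 xE).
have [q qE] := vlineP _ _ (mem_galNorm gal1 xE).
exists s, q; rewrite -qE -sE; split=> //; last first.
  move=> x1; rewrite /galNorm (eq_bigr (fun=> x)) ?prodr_const ?G2 // => g Gg.
  exact: (fixed_gal (sub1v E)).
have [g gP GE] : exists2 g, g != 1%g & 'Gal(E / 1)%g = [set 1%g; g]%SET.
  have /eqP/cards2P[a [b [ab GE]]] := G2.
  have : 1%g \in 'Gal(E / 1)%g by exact: group1.
  rewrite GE !inE => /orP[/eqP a1|/eqP b1]; first by exists b; rewrite a1 1?eq_sym.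
  by exists a; rewrite b1 // finset.setUC.
have g1 : 1%g \notin [set g]%SET by rewrite inE eq_sym.
rewrite /galNorm /galTrace GE !big_setU1 //= !big_set1 gal_id; ring.
Qed.
End Quadratic.

(** The polynomials are X^2 + X - 1, X^2 - 2, X^2 - X - 1 and X^2 - 3, of
    discriminants 5, 8, 5 and 12, none of which is a rational square. *)
Lemma real_generator_quadratic (F : fieldType) n (z : F) : n.-primitive_root z ->
  n \in [:: 5; 8; 10; 12]%N ->
  exists (b c : int) (k p : nat), [/\ prime p, (0 < k)%N, b ^+ 2 + 4 * c = (k ^ 2 * p)%N
    & (z + z^-1) ^+ 2 = b%:~R * (z + z^-1) + c%:~R].
Proof.
move=> prim_z n_in.
have z0 : z != 0 by rewrite (prim_root_eq0 prim_z); case: eqP n_in => // ->.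
have zne k : (0 < k < n)%N -> z ^+ k - 1 != 0.
  by case/andP=> k0 kn; rewrite subr_eq0 -(prim_order_dvd prim_z) gtnNdvd.
have zn := prim_expr_order prim_z.
have fin (b c : int) (v : F) : v != 0 ->
    v * ((z ^+ 2 + 1) ^+ 2 - b%:~R * z * (z ^+ 2 + 1) - c%:~R * z ^+ 2) = z ^+ n - 1 ->
    (z + z^-1) ^+ 2 = b%:~R * (z + z^-1) + c%:~R.
  rewrite zn subrr => v0 /eqP; rewrite mulf_eq0 (negPf v0) => /eqP Q0.
  apply/(mulfI (expf_neq0 2 z0))/eqP; rewrite -subr_eq0 -Q0; apply/eqP.
  by field.
move: n_in; rewrite !inE => /or4P[] /eqP nE; rewrite {}nE in zne fin {prim_z zn}.
  (* each multiplier v completes the n-th cyclotomic polynomial,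
     which is z^2 times the quadratic relation, into z^n - 1 *)
- exists (-1), 1, 1%N, 5%N; split=> //; apply: (fin _ _ (z - 1)); last by ring.
  by have := zne 1%N isT; rewrite expr1.
- exists 0, 2, 2%N, 2%N; split=> //; apply: (fin _ _ (z ^+ 4 - 1)); last by ring.
  exact: (zne 4).
- exists 1, 1, 1%N, 5%N; split=> //; apply: (fin _ _ ((z + 1) * (z ^+ 5 - 1))); last by ring.
  rewrite mulf_neq0 ?zne //; have := zne 2 isT; rewrite subr_sqr_1 mulf_eq0 negb_or.
  by case/andP.
- exists 0, 3, 2%N, 3%N; split=> //; apply: (fin _ _ ((z ^+ 2 + 1) * (z ^+ 6 - 1))); last by ring.
  rewrite mulf_neq0 ?zne //; have := zne 4 isT.
  by rewrite (exprM z 2 2) subr_sqr_1 mulf_eq0 negb_or; case/andP.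
Qed.

Lemma real_subfield_quadratic (L : splittingFieldType rat) n (z : L) :
  n.-primitive_root z -> n \in [:: 5; 8; 10; 12]%N ->
  galois 1 <<1; z + z^-1>> /\ #|'Gal(<<1; z + z^-1>> / 1)%g| = 2.
Proof.
move=> prim_z n_in.
have [b [c [k [p [p_pr k_gt0 disc hE]]]]] := real_generator_quadratic prim_z n_in.
move: hE; set h := z + z^-1 => hE.
have intA (m : int) : m%:~R%:A = m%:~R :> L by rewrite scaler_int.
apply: (@quadratic_galois L h b%:~R c%:~R); last by rewrite !intA.
apply/negP => /vlineP[r rE].
have /eqP := rat_sqr_neq_prime ((2 * r - b%:~R) / k%:R) p_pr; apply.
have k0 : k%:R != 0 :> rat by rewrite pnatr_eq0 -lt0n.
have {}hE : r ^+ 2 = b%:~R * r + c%:~R.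
  apply: (fmorph_inj (in_alg L)); rewrite rmorphXn rmorphD rmorphM /= -rE hE.
  by rewrite !intA.
have /(congr1 (intr : int -> rat)) := disc.
rewrite rmorphD rmorphM rmorphXn /= -[_%:~R in RHS]/((k ^ 2 * p)%:R) natrM natrX.
rewrite (_ : 4%:~R = 4) // => dE.
rewrite expr_div_n; apply: (mulIf (expf_neq0 2 k0)); rewrite divfK ?expf_neq0 //.
rewrite [RHS]mulrC -dE (_ : c%:~R = r ^+ 2 - b%:~R * r); last by rewrite hE addrC addKr.
ring.
Qed.

(** * Norms in N_2 *)

(** The divisors greater than 1 of 16, 9, 5 and 12 are the parameters a in the
    definition of the set N; whether q or q^-1 is in N depends on which of the
    numerator and denominator is larger. *)
Lemma small_norm_parts_N2 (q : rat) :
  small_norm_part `|numq q|%N -> small_norm_part `|denq q|%N -> N2 q.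
Proof.
have inlist a : small_norm_part a -> a = 1%N \/ a \in [:: 2; 3; 4; 5; 6; 8; 9; 12; 16]%N.
  move=> Pa; have : (a <= 16)%N by case/or4P: Pa => /dvdn_leq H; rewrite (leq_trans (H isT)).
  by do 17?[case: a Pa => [|a] Pa //]; try (by left); try (by right); case/or4P: Pa.
move=> Pa Pb; have co := coprime_num_den q.
pose a := `|numq q|%N; pose b := `|denq q|%N.
have b0 : (0 < b)%N by rewrite absz_gt0 denq_eq0.
have a0 : (0 < a)%N by have := inlist _ Pa; rewrite -/a => -[->//|]; case: (a).
have qE : q = a%:R / b%:R \/ q = - (a%:R / b%:R).
  have -> : b%:R = (denq q)%:~R :> rat by rewrite natr_absz gtr0_norm // denq_gt0.
  rewrite /a natr_absz; case: (ger0P (numq q)) => _; [left|right].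
    by rewrite divq_num_den.
  by rewrite mulrNz mulNr opprK divq_num_den.
have inN (c d : nat) : c \in [:: 2; 3; 4; 5; 6; 8; 9; 12; 16]%N -> (0 < d)%N -> (d < c)%N ->
  coprime c d ->
    N (c%:R / d%:R) /\ N (- (c%:R / d%:R)).
  move=> cl d0 dc cd; have dn : Defs.down c (c%:R / d%:R) by exists d.
  by split; exists c => //; [left|right; exists (c%:R / d%:R)].
rewrite /N2; case: (ltngtP a b) => [ab|ba|ab].
- right; have [b1|bl] := inlist _ Pb; first by move: ab; rewrite /b b1 ltnNge a0.
  have [Np Nm] := inN b a bl a0 ab (etrans (coprime_sym b a) co).
  have VE : (b%:R / a%:R) ^ (-1) = a%:R / b%:R :> rat by rewrite -invr_expz expr1z invf_div.
  case: qE => ->; [exists (b%:R / a%:R)|exists (- (b%:R / a%:R))] => //.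
  by rewrite -VE -!invr_expz !expr1z invrN.
- left; right; have [a1|al] := inlist _ Pa; first by move: ba; rewrite /a a1 ltnNge b0.
  by have [N1 N2] := inN a b al b0 ba co; case: qE => ->.
- have a1 : a = 1%N by move: co; rewrite -/a -/b -ab /coprime gcdnn => /eqP.
  by left; left; left; case: qE; rewrite -ab a1 divr1 => ->; [right|left].
Qed.

Lemma cross_ratio_quotients (F : fieldType) (v1 v2 v3 v4 : F) :
  v3 != 0 -> v4 != 0 -> v3 != v2 -> v4 != v1 ->
  (v3 - v1) * (v4 - v2) / ((v3 - v2) * (v4 - v1)) * ((1 - v2 / v3) * (1 - v1 / v4)) =
  (1 - v1 / v3) * (1 - v2 / v4).
Proof.
by move=> v30 v40 v32 v41; field; rewrite v30 v40 !subr_eq0 v32 v41.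
Qed.

(** The cross ratio lives both in K and in the field L generated by the m-th
    roots of unity; only its quadratic equation, with rational coefficients, is
    carried from K to L. *)
Lemma root_of_unity_cross_ratio_norm (R : realType) (n m : nat)
    (K : cyclotomic_field R n) (x : K) (w1 w2 w3 w4 : R[i]) :
  n \in [:: 5; 8; 10; 12]%N -> x \in real_subfield K ->
  (0 < m)%N -> w1 ^+ m = 1 -> w2 ^+ m = 1 -> w3 ^+ m = 1 -> w4 ^+ m = 1 ->
  w3 != w1 -> w4 != w2 -> w3 != w2 -> w4 != w1 ->
  cf_emb K x = (w3 - w1) * (w4 - w2) / ((w3 - w2) * (w4 - w1)) ->
  exists2 q : rat, N2 q & real_norm x = ratr q.
Proof.
move=> n_in xK m0 w1m w2m w3m w4m w31 w42 w32 w41 xE.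
have n0 : (0 < n)%N by case: n n_in {K x xK xE}.
have prim_z : n.-primitive_root (cf_zeta K).
  by rewrite -(fmorph_primitive_root (cf_emb K)) cf_emb_zeta zetaC_prim.
have [gal1 G2] := real_subfield_quadratic prim_z n_in.
have [s [q [qN xq x1]]] := galNorm_order2 gal1 G2 xK.
exists q; last by rewrite -alg_num_field.
have [L] := cyclotomic_field_exists R m0.
have embA (n' : nat) (F : cyclotomic_field R n') (r : rat) : cf_emb F r%:A = ratr r.
  by rewrite alg_num_field fmorph_rat.
have inL (w : R[i]) : w ^+ m = 1 -> exists v : L, cf_emb L v = w.
  move=> wm; have [k ->] := prim_rootP (zetaC_prim R m0) wm.
  by exists (cf_zeta L ^+ k); rewrite rmorphXn /= cf_emb_zeta.
have [v1 v1E] := inL _ w1m; have [v2 v2E] := inL _ w2m.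
have [v3 v3E] := inL _ w3m; have [v4 v4E] := inL _ w4m.
have inj := fmorph_inj (cf_emb L).
have vm v w : cf_emb L v = w -> w ^+ m = 1 -> v ^+ m = 1.
  by move=> vE wm; apply: inj; rewrite rmorphXn rmorph1 /= vE.
have vneq v v' w w' : cf_emb L v = w -> cf_emb L v' = w' -> w != w' -> v != v'.
  by move=> <- <-; apply: contra_neq => ->.
have v0 (v : L) : v ^+ m = 1 -> v != 0.
  by apply: contra_eq_neq => ->; rewrite expr0n (gtn_eqF m0) eq_sym oner_neq0.
have v1m := vm _ _ v1E w1m; have v2m := vm _ _ v2E w2m.
have v3m := vm _ _ v3E w3m; have v4m := vm _ _ v4E w4m.
have v31 := vneq _ _ _ _ v3E v1E w31; have v42 := vneq _ _ _ _ v4E v2E w42.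
have v32 := vneq _ _ _ _ v3E v2E w32; have v41 := vneq _ _ _ _ v4E v1E w41.
pose y := (v3 - v1) * (v4 - v2) / ((v3 - v2) * (v4 - v1)).
have yE : cf_emb L y = cf_emb K x.
  by rewrite xE /y !(rmorphM, fmorphV, rmorphB) /= v1E v2E v3E v4E.
have dm (v v' : L) : v ^+ m = 1 -> v' ^+ m = 1 -> (v / v') ^+ m = 1.
  by move=> vm1 vm1'; rewrite expr_div_n vm1 vm1' divr1.
have dn (v v' : L) : v' ^+ m = 1 -> v' != v -> v / v' != 1.
  move=> /v0 v'0; apply: contra_neq => vv'; apply: esym.
  by rewrite -[LHS](divfK v'0) vv' mul1r.
suff /andP[Pa Pb] : small_norm_part `|numq q|%N && small_norm_part `|denq q|%N by apply:
  small_norm_parts_N2.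
have yD : y * ((1 - v2 / v3) * (1 - v1 / v4)) = (1 - v1 / v3) * (1 - v2 / v4).
  exact: cross_ratio_quotients (v0 _ v3m) (v0 _ v4m) v32 v41.
have yq : y ^+ 2 - s%:A * y + q%:A = 0.
  apply: inj; rewrite rmorph0 -[RHS](rmorph0 (cf_emb K)) -xq.
  have morphQ (F : fieldType) (f : {rmorphism F -> R[i]}) (u v w : F) :
      f (u ^+ 2 - v * u + w) = f u ^+ 2 - f v * f u + f w.
    by rewrite rmorphD rmorphB rmorphXn rmorphM.
  by rewrite !morphQ yE !embA.
have y1 : y \in 1%VS -> q%:A = y ^+ 2.
  move=> /vlineP[r yr]; apply: inj; rewrite rmorphXn /= yE embA.
  rewrite -rmorphXn -x1 ?embA //; apply/vlineP; exists r.
  by apply: (fmorph_inj (cf_emb K)); rewrite -yE yr !embA.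
exact: (cross_ratio_norm_bound m0 (dm _ _ v1m v3m) (dm _ _ v2m v4m) (dm _ _ v2m v3m)
  (dm _ _ v1m v4m) (dn _ _ v3m v31) (dn _ _ v4m v42) (dn _ _ v3m v32) (dn _ _ v4m v41) yD yq y1).
Qed.

(** * Polar angles *)

Section Trigo.
Variable R : realType.
Implicit Types a b x y : R.

Lemma sin_gt0_gt0 a : - pi < a < pi -> 0 < sin a -> 0 < a.
Proof.
case/andP=> a1 a2; apply: contraTT; rewrite -!leNgt => a0.
by rewrite -oppr_ge0 -sinN sin_ge0_pi // oppr_ge0 a0 lerNl ltW.
Qed.

Lemma cot_lt_gt a b : 0 < a < pi -> 0 < b < pi ->
  cos b / sin b < cos a / sin a -> a < b.
Proof.
move=> a_in b_in; have [sa sb] := (sin_gt0_pi a_in, sin_gt0_pi b_in).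
rewrite ltr_pdivrMr // mulrAC ltr_pdivlMr // => cab.
move: a_in b_in => /andP[a0 api] /andP[b0 bpi].
rewrite -subr_gt0; apply: sin_gt0_gt0; first by apply/andP; split; lra.
by rewrite sinB subr_gt0 [ltRHS]mulrC.
Qed.

Lemma polar x y : (x != 0) || (y != 0) -> exists r a,
  [/\ 0 < r, - pi < a <= pi, x = r * cos a & y = r * sin a].
Proof.
move=> xy0; pose r := Num.sqrt (x ^+ 2 + y ^+ 2).
have r2 : 0 < x ^+ 2 + y ^+ 2.
  have [x2 y2] := (sqr_ge0 x, sqr_ge0 y); case/orP: xy0 => n0.
    by have : 0 < x ^+ 2 by [rewrite exprn_even_gt0]; lra.
  by have : 0 < y ^+ 2 by [rewrite exprn_even_gt0]; lra.
have r0 : 0 < r by rewrite sqrtr_gt0.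
have rr : r ^+ 2 = x ^+ 2 + y ^+ 2 by rewrite sqr_sqrtr // ltW.
have xr : - 1 <= x / r <= 1.
  rewrite -ler_norml normrM normfV (gtr0_norm r0) ler_pdivrMr // mul1r.
  by rewrite -(@ler_pXn2r _ 2) ?nnegrE ?normr_ge0 ?(ltW r0) // real_normK ?num_real // rr lerDl
    sqr_ge0.
have xr_in : x / r \in `[(-1), 1]. by rewrite in_itv.
have cE : x = r * cos (acos (x / r)).
  by rewrite (acosK xr_in) mulrCA divff ?mulr1 // gt_eqF.
have sE : `|y| = r * sin (acos (x / r)).
  rewrite sin_acos // -{1}(sqrtr_sqr y) (_ : y ^+ 2 = r ^+ 2 * (1 - (x / r) ^+ 2)).
    by rewrite sqrtrM ?sqr_ge0 // sqrtr_sqr gtr0_norm.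
  rewrite expr_div_n mulrBr mulr1 [X in _ - X]mulrC divfK ?expf_neq0 ?gt_eqF // rr; ring.
have a0 := acos_ge0 xr; have api := acos_lepi xr.
have pi0 := pi_gt0 R.
have [y0|y0] := lerP 0 y.
  exists r, (acos (x / r)); split=> //; last by rewrite -sE ger0_norm.
  by rewrite api andbT; lra.
exists r, (- acos (x / r)); split=> //; first (apply/andP; split).
- rewrite ltrN2 lt_neqAle api andbT; apply/eqP => aE; move: sE.
  by rewrite aE sinpi mulr0 => /eqP; rewrite normr_eq0 => /eqP yE; move: y0; rewrite yE ltxx.
- by lra.
- by rewrite cosN.
- by rewrite sinN mulrN -sE ltr0_norm // opprK.
Qed.

Lemma periodic_int (f : R -> R) (T : R) : periodic f T ->
  forall a (k : int), f (a + T * k%:~R) = f a.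
Proof.
move=> fT a [n|n]; first by rewrite -pmulrn mulr_natr periodicn.
rewrite NegzE mulrNz -[in RHS](subrK (T * n.+1%:R) a) mulr_natr (periodicn fT).
by rewrite -mulr_natr mulrN.
Qed.

End Trigo.

(** * Two alternating finite sets seen from one direction *)

Section Frame.
Variables (R : realType) (I : finType) (sg : I -> bool) (p : I -> I).
Hypotheses (pK : involutive p) (sg_p : forall i, sg (p i) = ~~ sg i).
Implicit Types (X Y key : I -> R) (i j k : I).

(** The points (X i, Y i) are taken relative to a common point of two convex
    sets; sg i tells to which set i belongs.  No point of one kind is in the
    triangle spanned by the origin and two points of the other kind. *)
Definition unmixed X Y := forall i j k (s t : R), sg i = sg j -> sg k != sg i ->
  0 <= s -> 0 <= t -> s + t <= 1 ->
  X k = s * X i + t * X j -> Y k = s * Y i + t * Y j -> False.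

Definition is_right X i := X (p i) < X i.

(** The first axis is parallel to the direction, so that p is the pairing along
    the lines Y = constant.  The polar angles [key] of the right and the left
    ends of the pairs are chosen in different intervals so that, going down
    through the figure, the right angles decrease and the left angles increase
    at each change of kind, without a jump at the line through the origin. *)
Record frame X Y key := Frame {
  frame_unmixed : unmixed X Y;
  frame_level : forall i, Y (p i) = Y i;
  frame_polar : forall i, exists2 r, 0 < r &
    X i = r * cos (key i) /\ Y i = r * sin (key i);
  frame_right : forall i, is_right X i -> - pi < key i < pi;
  frame_left : forall i, ~~ is_right X i -> 0 < key i < 2 * pi }.

Section PlanarSigns.
Variables X Y : I -> R.
Hypotheses (UM : unmixed X Y) (Yp : forall i, Y (p i) = Y i).

Lemma unmixed_neq i : X (p i) != X i.
Proof.
apply/eqP => XE; apply: (UM (i := p i) (j := p i) (k := i) (s := 1) (t := 0));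
  rewrite ?mul1r ?mul0r ?addr0 ?Yp ?sg_p //; by case: (sg i).
Qed.

Lemma right_p i : is_right X (p i) = ~~ is_right X i.
Proof. by rewrite /is_right pK -leNgt lt_neqAle eq_sym unmixed_neq. Qed.

Let xi i := X i / Y i.

(** The point of height Y k on the segment from the origin to i is in the convex
    hull of the kind of i, so that a point k of the other kind cannot lie
    between it and j.  The abscissas at height Y k are proportional to
    xi = X / Y. *)
Lemma not_between i j k : 0 < Y k -> Y j = Y k -> Y k <= Y i ->
  sg i = sg j -> sg k != sg i ->
  ~ (xi i <= xi k <= xi j) /\ ~ (xi j <= xi k <= xi i).
Proof.
move=> Yk0 Yj Yki sij ski.
have Yi0 : 0 < Y i := lt_le_trans Yk0 Yki.
have XE l : 0 < Y l -> X l = Y l * xi l by move=> l0; rewrite /xi mulrC divfK ?gt_eqF.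
have main t : 0 <= t <= 1 -> xi k = (1 - t) * xi i + t * xi j -> False.
  move=> /andP[t0 t1] kE; pose s := (1 - t) * (Y k / Y i).
  have q0 : 0 <= Y k / Y i by rewrite divr_ge0 ?ltW.
  have q1 : Y k / Y i <= 1 by rewrite ler_pdivrMr // mul1r.
  have sE : s * Y i = (1 - t) * Y k by rewrite /s -mulrA divfK ?gt_eqF.
  apply: (UM (i := i) (j := j) (k := k) (s := s) (t := t)) => //.
  - by rewrite mulr_ge0 // subr_ge0.
  - have : s <= (1 - t) * 1 by rewrite ler_wpM2l // subr_ge0.
    by lra.
  - by rewrite !XE ?Yj // mulrA sE kE; ring.
  - by rewrite sE Yj; ring.
have btw u v w : u <= w -> w <= v -> exists2 t : R, 0 <= t <= 1 & w = (1 - t) * u + t * v.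
  move=> uw wv; have [uv|uv] := eqVneq u v.
    by exists 0; rewrite ?lexx ?ler01 //; move: uw wv; rewrite uv; lra.
  have uv0 : 0 < v - u by rewrite subr_gt0 lt_neqAle uv (le_trans uw).
  exists ((w - u) / (v - u)); last by field; rewrite gt_eqF.
  by rewrite ler_pdivrMr // mul1r lerD2r wv andbT divr_ge0 // ?(ltW uv0) // subr_ge0.
split=> /andP[h1 h2]; have [t /andP[t0 t1] tE] := btw _ _ _ h1 h2.
  by apply: (main t) => //; rewrite t0.
by apply: (main (1 - t)); [apply/andP; split; lra|rewrite tE; ring].
Qed.

(** Otherwise an end of the lower line would be caught between the opposite end
    of that line and a point of the same kind as this opposite end, brought
    down from the upper line as in [not_between]. *)
Lemma upper_same i j : is_right X i -> is_right X j -> 0 < Y j -> Y j <= Y i ->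
  sg i = sg j -> xi (p j) < xi i /\ xi (p i) < xi j.
Proof.
move=> ri rj Yj0 Yji sij; have Yi0 := lt_le_trans Yj0 Yji.
have rj' : xi (p j) < xi j by rewrite /xi Yp ltr_pM2r ?invr_gt0.
have [B1 _] : ~ (xi i <= xi (p j) <= xi j) /\ ~ (xi j <= xi (p j) <= xi i).
  by apply: not_between; rewrite ?Yp ?sg_p -?sij //; case: (sg i).
have [_ B2] : ~ (xi (p i) <= xi j <= xi (p j)) /\ ~ (xi (p j) <= xi j <= xi (p i)).
  by apply: not_between; rewrite ?Yp ?sg_p -?sij //; case: (sg i).
split; rewrite ltNge; apply/negP => h; [apply: B1|apply: B2].
  by rewrite h ltW.
by rewrite h ltW.
Qed.

(** The argument of [upper_same]; as the kinds are exchanged between the two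
    lines, it forces the nesting of the clusters instead. *)
Lemma upper_diff i j : is_right X i -> is_right X j -> 0 < Y j -> Y j <= Y i ->
  sg i != sg j -> xi i < xi j /\ xi (p j) < xi (p i).
Proof.
move=> ri rj Yj0 Yji sij; have Yi0 := lt_le_trans Yj0 Yji.
have rj' : xi (p j) < xi j by rewrite /xi Yp ltr_pM2r ?invr_gt0.
have [_ B1] : ~ (xi i <= xi j <= xi (p j)) /\ ~ (xi (p j) <= xi j <= xi i).
  by apply: not_between; rewrite ?Yp ?sg_p //; move: sij; case: (sg i); case: (sg j).
have [B2 _] : ~ (xi (p i) <= xi (p j) <= xi j) /\ ~ (xi j <= xi (p j) <= xi (p i)).
  by apply: not_between; rewrite ?Yp ?sg_p //; move: sij; case: (sg i); case: (sg j).
split; rewrite ltNge; apply/negP => h; [apply: B1|apply: B2].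
  by rewrite h ltW.
by rewrite h ltW.
Qed.

Lemma upper_right_left i j : is_right X i -> ~~ is_right X j -> 0 < Y i -> 0 < Y j ->
  xi j < xi i.
Proof.
move=> ri lj Yi0 Yj0; have rpj : is_right X (p j) by rewrite right_p.
have rpj' : xi j < xi (p j).
  by rewrite /xi Yp ltr_pM2r ?invr_gt0 //; move: rpj; rewrite /is_right pK.
have ri' : xi (p i) < xi i by rewrite /xi Yp ltr_pM2r ?invr_gt0.
have [le|/ltW le] := leP (Y j) (Y i); have [sE|sN] := eqVneq (sg i) (sg (p j)).
- by have := upper_same ri rpj; rewrite pK Yp => -[].
- by have := upper_diff ri rpj; rewrite pK Yp => /(_ Yj0 le sN)[_ h]; apply: lt_trans ri'.
- by have := upper_same rpj ri; rewrite pK Yp => /(_ Yi0 le (esym sE))[].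
have := upper_diff rpj ri; rewrite pK Yp eq_sym => /(_ Yi0 le sN)[h _].
exact: lt_trans h.
Qed.

Lemma upper_level_type i j : is_right X i -> is_right X j -> 0 < Y i -> Y i = Y j -> sg i = sg j.
Proof.
move=> ri rj Yi0 Yij; apply/eqP/negPn/negP => sij.
have Yj0 : 0 < Y j by rewrite -Yij.
have [h _] : xi i < xi j /\ xi (p j) < xi (p i) by apply: upper_diff; rewrite // Yij.
have [] : xi j < xi i /\ xi (p i) < xi (p j) by apply: upper_diff; rewrite // ?Yij // eq_sym.
by rewrite ltNge ltW.
Qed.

(** Two ends on the same side of the origin would put the nearer one on the
    segment from the origin to the farther one, which is of the other kind. *)
Lemma zero_level i : Y i = 0 -> is_right X i -> 0 < X i /\ X (p i) < 0.
Proof.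
rewrite /is_right => Y0 ri.
have scale k l (s : R) : sg k != sg l -> Y k = 0 -> Y l = 0 -> 0 <= s <= 1 ->
    X k = s * X l -> False.
  move=> skl Yk Yl /andP[s0 s1] XE.
  by apply: (UM (i := l) (j := l) (k := k) (s := s) (t := 0));
    rewrite ?mul0r ?addr0 ?Yk ?Yl ?mulr0.
have Yp0 : Y (p i) = 0 by rewrite Yp.
have sp : sg i != sg (p i) by rewrite sg_p; case: (sg i).
split; rewrite ltNge; apply/negP => h.
  have p0 : X (p i) < 0 by exact: lt_le_trans ri h.
  apply: (scale i (p i) (X i / X (p i))) => //; last by rewrite divfK // lt_eqF.
  by rewrite ler_ndivrMr // mul1r (ltW ri) andbT mulr_le0 // invr_le0 (ltW p0).
have i0 : 0 < X i by exact: le_lt_trans ri.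
apply: (scale (p i) i (X (p i) / X i)) => //; last by rewrite divfK // gt_eqF.
  by rewrite eq_sym.
by rewrite ler_pdivrMr // mul1r (ltW ri) andbT mulr_ge0 // invr_ge0 (ltW i0).
Qed.

Lemma zero_level_type i j : is_right X i -> is_right X j -> Y i = 0 -> Y j = 0 -> sg i = sg j.
Proof.
move=> ri rj Yi Yj; apply/eqP/negPn/negP => sij.
wlog le : i j ri rj Yi Yj sij / X i <= X j.
  by move=> H; have [/H|/ltW/H] := leP (X i) (X j); apply; rewrite // eq_sym.
have [Xi0 _] := zero_level Yi ri; have [Xj0 _] := zero_level Yj rj.
apply: (UM (i := j) (j := j) (k := i) (s := X i / X j) (t := 0)) => //.
- by rewrite divr_ge0 ?ltW.
- by rewrite addr0 ler_pdivrMr // mul1r.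
- by rewrite mul0r addr0 divfK // gt_eqF.
- by rewrite Yi Yj !mulr0 addr0.
Qed.
End PlanarSigns.

Lemma unmixed_opp X Y : unmixed X Y -> unmixed X (fun i => - Y i).
Proof.
move=> UM i j k s t sij sk s0 t0 st XE YE; apply: (UM i j k s t) => //.
by apply: oppr_inj; rewrite YE; ring.
Qed.

Lemma unmixed_oppl X Y : unmixed X Y -> unmixed (fun i => - X i) Y.
Proof.
move=> UM i j k s t sij sk s0 t0 st XE YE; apply: (UM i j k s t) => //.
by apply: oppr_inj; rewrite XE; ring.
Qed.

Lemma right_type X Y i j : unmixed X Y -> (forall i, Y (p i) = Y i) ->
  is_right X i -> is_right X j -> Y i = Y j -> sg i = sg j.
Proof.
move=> UM Yp ri rj Yij; have [Y0|Y0|Y0] := ltgtP (Y i) 0.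
- apply: (@upper_level_type X (fun i => - Y i)) => //; first exact: unmixed_opp.
  + by move=> k; rewrite Yp.
  + by rewrite oppr_gt0.
  + by rewrite Yij.
- exact: (@upper_level_type X Y).
- by apply: (@zero_level_type X Y); rewrite -?Yij.
Qed.

(** The reflection Y |-> - Y keeps right and left ends, and transfers the
    results on the upper half-plane to the lower one. *)
Lemma frame_opp X Y key : frame X Y key ->
  frame X (fun i => - Y i) (fun i => if is_right X i then - key i else 2 * pi - key i).
Proof.
case=> UM Yp pol kr kl; split.
- exact: unmixed_opp.
- by move=> i; rewrite Yp.
- move=> i; have [r r0 [XE YE]] := pol i; exists r => //.
  case: ifP => _; first by rewrite cosN sinN mulrN -YE.
  by rewrite cosB sinB mulr_natl cos2pi sin2pi XE YE; split; ring.
- by move=> i ri; rewrite ri; have /andP[] := kr i ri; lra.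
- by move=> i li; rewrite (negPf li); have /andP[] := kl i li; lra.
Qed.

Lemma right_oppl X i : is_right (fun i => - X i) i = (X i < X (p i)).
Proof. by rewrite /is_right ltrN2. Qed.

(** The reflection X |-> - X exchanges right and left ends. *)
Lemma frame_oppl X Y key : frame X Y key -> frame (fun i => - X i) Y (fun i => pi - key i).
Proof.
case=> UM Yp pol kr kl; have rN i : is_right (fun i => - X i) i = ~~ is_right X i.
  by rewrite right_oppl -(right_p UM Yp) /is_right pK.
split=> //.
- exact: unmixed_oppl.
- move=> i; have [r r0 [XE YE]] := pol i; exists r => //.
  by rewrite cosB sinB cospi sinpi XE YE; split; ring.
- by move=> i; rewrite rN => /kl; lra.
- by move=> i; rewrite rN negbK => /kr; lra.
Qed.

Section RightKeys.
Variables X Y key : I -> R.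
Hypothesis F : frame X Y key.
Let UM := frame_unmixed F.
Let Yp := frame_level F.

Lemma frame_right_gt0 i : is_right X i -> (0 < Y i) = (0 < key i).
Proof.
move=> ri; have [r r0 [_ YE]] := frame_polar F i; have /andP[k1 k2] := frame_right F ri.
rewrite YE pmulr_rgt0 //; apply/idP/idP => [|k0]; last by rewrite sin_gt0_pi // k0.
by apply: sin_gt0_gt0; rewrite k1.
Qed.

Lemma frame_left_gt0 i : ~~ is_right X i -> (0 < Y i) = (key i < pi).
Proof.
move=> li; have [r r0 [_ YE]] := frame_polar F i; have /andP[k1 k2] := frame_left F li.
rewrite YE pmulr_rgt0 //; apply/idP/idP => [|k0]; last by rewrite sin_gt0_pi // k1.
have -> : sin (key i) = sin (pi - key i) by rewrite sinB sinpi cospi; ring.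
by move=> /sin_gt0_gt0; rewrite subr_gt0; apply; lra.
Qed.

Lemma key_lt_xi i j : 0 < key i < pi -> 0 < key j < pi ->
  X j / Y j < X i / Y i -> key i < key j.
Proof.
have [r r0 [XE YE]] := frame_polar F i; have [r' r0' [XE' YE']] := frame_polar F j.
move=> ki kj; rewrite XE YE XE' YE' !invfM !mulrA [r * _ * _]mulrAC [r' * _ * _]mulrAC.
rewrite divff ?gt_eqF // divff ?gt_eqF // !mul1r; exact: cot_lt_gt.
Qed.

Lemma right_lt_left i j : is_right X i -> ~~ is_right X j -> key i < key j.
Proof.
move=> ri lj; have [ki|ki] := leP (key i) 0.
  by have /andP[] := frame_left F lj; lra.
have [kj|kj] := leP pi (key j); first by have /andP[] := frame_right F ri; lra.
apply: key_lt_xi.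
- by rewrite ki; have /andP[] := frame_right F ri.
- by rewrite kj; have /andP[->] := frame_left F lj.
- by apply: (upper_right_left UM Yp) => //; rewrite ?(frame_right_gt0 ri) ?(frame_left_gt0 lj).
Qed.

Lemma right_lower_upper i j : is_right X i -> is_right X j -> sg i != sg j -> Y j <= Y i ->
  0 < Y j -> key j < key i.
Proof.
move=> ri rj sij le Yj0; have Yi0 := lt_le_trans Yj0 le.
have [h _] := upper_diff UM Yp ri rj Yj0 le sij.
apply: key_lt_xi h; rewrite -frame_right_gt0 // ?Yj0 ?Yi0 /=.
  by have /andP[] := frame_right F rj.
by have /andP[] := frame_right F ri.
Qed.
End RightKeys.

Section ReflectedKeys.
Variables X Y key : I -> R.
Hypothesis F : frame X Y key.

(** Together with [right_lt_left], this says that all the chosen angles lie in a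
    window of length less than 2 pi. *)
Lemma left_lt_right2pi i j : is_right X i -> ~~ is_right X j -> key j < key i + 2 * pi.
Proof.
move=> ri lj; have := right_lt_left (frame_opp F) ri lj.
by rewrite ri (negPf lj); lra.
Qed.

(** The angular monotonicity behind the labelling: going down, each change of
    kind moves the right end clockwise. *)
Lemma right_lower i j : is_right X i -> is_right X j -> sg i != sg j -> Y j <= Y i ->
  key j < key i.
Proof.
move=> ri rj sij le.
have UM := frame_unmixed F; have Yp := frame_level F.
have [Yj0|Yj0] := ltP 0 (Y j); first exact: (right_lower_upper F).
have [Yi0|Yi0] := ltP 0 (Y i).
  rewrite (frame_right_gt0 F) // in Yi0; apply: le_lt_trans Yi0.
  by rewrite leNgt -(frame_right_gt0 F) // -leNgt.
have Yij : Y j < Y i.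
  rewrite lt_neqAle le andbT; apply: contra_neq sij => Yij.
  exact: (right_type UM Yp ri rj (esym Yij)).
have FN := frame_opp F; have keyN k : is_right X k -> 0 < - Y k -> key k < 0.
  by move=> rk; rewrite (frame_right_gt0 FN) // rk oppr_gt0.
have kj : key j < 0 by apply: keyN; rewrite // oppr_gt0; lra.
have [Yi|Yi] := ltP (Y i) 0; last first.
  suff : 0 <= key i by lra.
  rewrite leNgt; apply/negP => ki; have := frame_right_gt0 FN ri.
  by rewrite ri !oppr_gt0 ki ltNge Yi.
have := right_lower_upper FN rj ri; rewrite ri rj eq_sym lerN2 oppr_gt0 ltrN2.
exact.
Qed.

End ReflectedKeys.

Section LeftKeys.
Variables X Y key : I -> R.
Hypothesis F : frame X Y key.
Lemma left_lower i j : ~~ is_right X i -> ~~ is_right X j -> sg i != sg j -> Y j <= Y i ->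
  key i < key j.
Proof.
move=> li lj sij le; have UM := frame_unmixed F; have Yp := frame_level F.
have rN k : is_right (fun i => - X i) k = ~~ is_right X k.
  by rewrite right_oppl -(right_p UM Yp) /is_right pK.
have := right_lower (frame_oppl F) (i := i) (j := j); rewrite !rN => /(_ li lj sij le); lra.
Qed.
End LeftKeys.
End Frame.

(** * Cyclic labellings *)

(** N i is the number of changes of tau met on the way down from the top to the
    height of i. *)
Lemma alternation_levels (R : realDomainType) (I : finType) (Y : I -> R) (tau : I -> bool) :
  (forall i j, Y i = Y j -> tau i = tau j) -> exists (N : I -> nat) (b : bool),
  [/\ forall i j, Y j <= Y i -> (N i <= N j)%N, forall i, odd (N i) = tau i (+) b
    & forall i v, (v <= N i)%N -> exists j, N j = v].
Proof.
move=> tauY.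
suff H (s : seq I) : uniq s -> sorted (fun i j => Y i <= Y j) s -> exists (N : I ->
  nat) (b : bool),
  [/\ {in s &, forall i j, Y j <= Y i -> (N i <= N j)%N}, {in s, forall i,
    odd (N i) = tau i (+) b}
    & {in s, forall i v, (v <= N i)%N -> exists2 j, j \in s & N j = v}].
  pose s := sort (fun i j => Y i <= Y j) (enum I).
  have [||N [b [N1 N2 N3]]] := H s.
  - by rewrite sort_uniq enum_uniq.
  - by apply: sort_sorted => i j; exact: le_total.
  have sI i : i \in s by rewrite mem_sort mem_enum.
  exists N, b; split=> [i j|i|i v le]; [exact: N1|exact: N2|].
  by have [j _] := N3 i (sI i) v le; exists j.
elim: s => [|i [|h s] IH] /=; first by exists (fun=> 0%N), false; split.
  move=> _ _; exists (fun=> 0%N), (tau i); split=> [//|j|j _ v].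
    by rewrite inE => /eqP ->; rewrite addbb.
  by rewrite leqn0 => /eqP ->; exists i; rewrite ?inE.
move=> /andP[i_s u_s] /andP[ih sorted_s]; have [N [b [N1 N2 N3]]] := IH u_s sorted_s.
have hmin x : x \in h :: s -> Y h <= Y x.
  rewrite inE => /predU1P[->//|xs].
  by have /allP/(_ x xs) := order_path_min (fun a b c => @le_trans _ _ (Y a) (Y b) (Y c))
    sorted_s.
have hs : h \in h :: s by rewrite inE eqxx.
have neq x : x \in h :: s -> (x == i) = false by move=> xs; apply: contraNF i_s => /eqP <-.
exists (fun x => if x == i then (N h + (tau h != tau i))%N else N x), b; split.
- move=> x y; rewrite ![_ \in i :: _]inE => /predU1P[->|xs] /predU1P[->|ys];
  rewrite ?eqxx ?neq //.
  + move=> yi; have hy := hmin y ys; have le : Y y <= Y h by exact: le_trans ih.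
    have -> : tau h = tau i by apply: tauY; apply/eqP; rewrite eq_le ih (le_trans hy).
    by rewrite eqxx addn0; exact: N1.
  + by move=> _; rewrite (leq_trans (N1 x h xs hs (hmin x xs))) // leq_addr.
  + exact: N1.
- move=> x; rewrite ![_ \in i :: _]inE => /predU1P[->|xs]; rewrite ?eqxx ?neq //; last exact: N2.
  by rewrite oddD N2 // oddb; case: (tau h); case: (tau i); case: b {N2}.
- move=> x; rewrite ![_ \in i :: _]inE => /predU1P[->|xs] v; rewrite ?eqxx ?neq //.
    rewrite leq_eqVlt => /predU1P[->|lev]; first by exists i; rewrite ?inE ?eqxx.
    have vh : (v <= N h)%N by move: lev; case: (_ != _); lia.
    by have [j js jv] := N3 h hs v vh; exists j; rewrite ?neq // inE js orbT.
  by move=> lev; have [j js jv] := N3 x xs v lev; exists j; rewrite ?neq // inE js orbT.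
Qed.

Section Labelling.
Variables (R : realType) (I : finType) (sg : I -> bool) (alpha : I -> R).

(** A pair (i, k) stands for the lift alpha i + 2 k pi of the polar angle of i
    to the universal cover of the circle.  A labelling numbers the clusters of
    successive points of the same kind in the order of these lifts, and m is
    the number of clusters around the circle. *)
Record labelling (m : nat) (g : I -> int -> int) : Prop := Labelling {
  lab_shift : forall i k, g i k = g i 0 + m%:Z * k;
  lab_mono : forall i j (k l : int), alpha i + 2 * pi * k%:~R <= alpha j + 2 * pi * l%:~R ->
    g i k <= g j l;
  lab_sign : forall i j k l, (2 %| g i k - g j l)%Z = (sg i == sg j);
  lab_onto : forall v, exists i k, g i k = v }.

(** If g increases by n between two lifts, then by surjectivity there is a
    chain of n changes of kind between them, and any other labelling
    increases by at least n as well. *)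
Lemma labelling_unique m m' g g' : labelling m g -> labelling m' g' ->
  forall i j k l, g' j l - g' i k = g j l - g i k.
Proof.
have step m1 m2 g1 g2 : labelling m1 g1 -> labelling m2 g2 ->
    forall (n : nat) i j k l, g1 j l = g1 i k + n.+1%:Z -> g2 i k + n.+1%:Z <= g2 j l.
  move=> L1 L2 n.
  have step0 i j k l : g1 j l = g1 i k + 1 -> g2 i k + 1 <= g2 j l.
    move=> E; have ne : g2 i k != g2 j l.
      have nd : ~~ (2 %| g2 j l - g2 i k)%Z.
        rewrite (lab_sign L2) -(lab_sign L1 j i l k) E.
        by have -> : g1 i k + 1 - g1 i k = 1 by lia.
      by apply: contraNneq nd => ->; rewrite subrr dvdz0.
    have : g2 i k <= g2 j l.
      apply: (lab_mono L2); have [//|/ltW h] := leP; have := lab_mono L1 h; lia.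
    by move: ne; lia.
  elim: n => [|n IH] i j k l E; first exact: step0.
  have [x [y xy]] := lab_onto L1 (g1 i k + 1).
  have E1 : g2 i k + 1 <= g2 x y by apply: (step0 i x k y); rewrite xy.
  have E2 : g2 x y + n.+1%:Z <= g2 j l by apply: IH; rewrite xy E; lia.
  by lia.
have up m1 m2 g1 g2 : labelling m1 g1 -> labelling m2 g2 ->
    forall i j k l, g1 i k < g1 j l -> g1 j l - g1 i k <= g2 j l - g2 i k.
  move=> L1 L2 i j k l lt; pose n := `|g1 j l - g1 i k|%N.-1.
  have := step _ _ _ _ L1 L2 n i j k l; rewrite /n; lia.
move=> L L' i j k l.
have [lt|lt|eq] := ltgtP (g i k) (g j l).
- by have := up _ _ _ _ L L' i j k l lt; have := up _ _ _ _ L' L i j k l; lia.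
- by have := up _ _ _ _ L L' j i l k lt; have := up _ _ _ _ L' L j i l k; lia.
- have := up _ _ _ _ L' L i j k l; have := up _ _ _ _ L' L j i l k; lia.
Qed.

Section Existence.
Variable p : I -> I.
Hypotheses (pK : involutive p) (sg_p : forall i, sg (p i) = ~~ sg i).
Variables (X Y key : I -> R) (beta : R).
Hypothesis F : frame sg p X Y key.
Hypothesis keyE : forall i, exists k : int, key i = alpha i + beta + 2 * pi * k%:~R.
Hypothesis (i0 : I) (sumX : \sum_(i | sg i) X i = \sum_(i | ~~ sg i) X i).

(** Right ends are numbered by - N and left ends by N + 1, where N counts the
    changes of kind of the right ends from the top; the two ends of a line thus
    have labels of sum 1.  The last level M contributes the labels - M and
    M + 1, hence m = 2 M + 2.  If M were 0, all the right ends would be of the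
    same kind, against the equality of the two sums of abscissas. *)
Lemma labelling_exists : exists m g, [/\ (3 < m)%N, labelling m g
  & forall i, (m %| g i 0 + g (p i) 0 - 1)%Z].
Proof.
have UM := frame_unmixed F; have Yp := frame_level F.
have rp := right_p pK sg_p UM Yp.
pose tau i := if is_right p X i then sg i else ~~ sg i.
have tau_p i : tau (p i) = tau i by rewrite /tau rp sg_p negbK; case: (is_right _ _ i).
have tauY i j : Y i = Y j -> tau i = tau j.
  have H a b : is_right p X a -> is_right p X b -> Y a = Y b -> tau a = tau b.
    move=> ra rb; rewrite /tau ra rb; exact: (right_type sg_p UM Yp ra rb).
  have [ri|li] := boolP (is_right p X i); have [rj|lj] := boolP (is_right p X j).
  - exact: H.
  - by rewrite -(tau_p j) -(Yp j); apply: H; rewrite // rp.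
  - by rewrite -(tau_p i) -(Yp i); apply: H; rewrite // rp.
  - by rewrite -(tau_p i) -(Yp i) -(tau_p j) -(Yp j); apply: H; rewrite // rp.
have [N [b [N1 N2 N3]]] := alternation_levels tauY.
have Np i : N (p i) = N i by apply/eqP; rewrite eqn_leq !N1 ?Yp.
have Ylt i j : (N i < N j)%N -> Y j <= Y i.
  by move=> Nij; have [//|/ltW/N1] := leP; rewrite leqNgt Nij.
(* right ends and left ends are handled alike, with opposite orders dir; two
   ends of the same kind are compared through a line of the intermediate level *)
have chain (S : pred I) (dir : I -> I -> Prop) (b' : bool) :
    (forall x y z, dir x y -> dir y z -> dir x z) ->
    (forall x, S x -> odd (N x) = sg x (+) b') -> (forall x, ~~ S x -> S (p x)) ->
    (forall x y, S x -> S y -> sg x != sg y -> Y y <= Y x -> dir x y) ->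
    forall i j, S i -> S j -> (N i < N j)%N -> dir i j.
  move=> dir_trans oddS Sp dirS i j Si Sj Nij.
  have [sij|sij] := eqVneq (sg i) (sg j); last by apply: dirS => //; exact: Ylt.
  have N2ij : (N i).+1 != N j.
    apply/eqP => NE; move: (oddS j Sj); rewrite -NE /= (oddS i Si) sij.
    by case: (_ (+) _).
  have [k kN] := N3 j _ Nij.
  wlog Sk : k kN / S k.
    by move=> H; have [|/Sp Spk] := boolP (S k); [exact: H|apply: (H (p k)); rewrite ?Np].
  have sk : sg k = ~~ sg i.
    by have := oddS k Sk; rewrite kN /= (oddS i Si); case: (sg k); case: (sg i); case: (b').
  apply: (dir_trans i k j); apply: dirS => //; first by rewrite sk; case: (sg i).
  - by apply: Ylt; rewrite kN.
  - by rewrite sk sij; case: (sg j).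
  - by apply: Ylt; rewrite kN ltn_neqAle N2ij.
have rchain i j : is_right p X i -> is_right p X j -> (N i < N j)%N -> key j < key i.
  apply: (chain _ (fun x y => key y < key x) b) => [x y z xy yz|x rx|x|x y].
  - exact: lt_trans yz xy.
  - by rewrite N2 /tau rx.
  - by rewrite rp.
  - exact: (right_lower sg_p F).
have lchain i j : ~~ is_right p X i -> ~~ is_right p X j -> (N i < N j)%N -> key i < key j.
  apply: (chain [pred x | ~~ is_right p X x] (fun x y => key x < key y) (~~ b)).
  - by move=> x y z; exact: lt_trans.
  - by move=> x /negPf lx; rewrite N2 /tau lx addNb addbN.
  - by move=> x /=; rewrite rp.
  - by move=> x y; exact: (left_lower pK sg_p F).
pose M := \max_i N i; pose m := (2 * M + 2)%N.
have NM i : (N i <= M)%N by exact: leq_bigmax.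
have [iM MN] : exists i, M = N i.
  by have [|i _ iE] := @eq_bigmax_cond I predT N; [apply/card_gt0P; exists i0|exists i].
have M_gt0 : (0 < M)%N.
  rewrite lt0n; apply/eqP => M0.
  have tb i : tau i = b.
    by have := N2 i; move: (NM i); rewrite M0 leqn0 => /eqP -> /=; case: (tau i); case: (b).
  have rb i : is_right p X i = (sg i == b) by have := tb i; rewrite /tau;
    case: (is_right _ _ i) => <-; case: (sg i).
  have sp : \sum_(i | sg i == b) X (p i) = \sum_(i | sg i != b) X i.
    by rewrite [RHS](reindex_inj (inv_inj pK)); apply: eq_bigl => i; rewrite sg_p;
      case: (sg i); case: (b).
  have : \sum_(i | sg i == b) X (p i) < \sum_(i | sg i == b) X i.
    have [j jb] : exists j, sg j == b.
      by have [sb|sb] := eqVneq (sg i0) b; [exists i0; exact/eqP|exists (p i0); rewrite sg_p;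
        move: sb; case: (sg i0); case: (b)].
    rewrite (bigD1 j) //= [ltRHS](bigD1 j) //= ltr_leD //; first by move: jb; rewrite -rb.
    by apply: ler_sum => i /andP[]; rewrite -rb => /ltW.
  suff -> : \sum_(i | sg i == b) X i = \sum_(i | sg i != b) X i by rewrite sp ltxx.
  case: (b); last apply: esym;
    by rewrite (eq_bigl sg) ?sumX => [|i]; [apply: eq_bigl => i|]; case: (sg i).
pose g0 i : int := if is_right p X i then - (N i)%:Z else (N i)%:Z + 1.
have [kap kapE] := boolp.choice keyE.
pose g i (k : int) : int := g0 i + m%:Z * (k - kap i).
have g0mono i j : key i <= key j -> g0 i <= g0 j.
  rewrite /g0; have [ri|li] := boolP (is_right p X i);
    have [rj|lj] := boolP (is_right p X j) => kij.
  - by have [|/(rchain _ _ ri rj)] := leqP (N j) (N i); [lia|rewrite ltNge kij].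
  - by lia.
  - by have := right_lt_left pK sg_p F rj li; rewrite ltNge kij.
  - by have [|/(lchain _ _ lj li)] := leqP (N i) (N j); [lia|rewrite ltNge kij].
have pi0 := pi_gt0 R.
(* all base angles lie in a window shorter than a turn, and all base labels in
   a window shorter than m, so that turns can be compared first *)
have key_width i j : key j < key i + 2 * pi.
  have [ri|li] := boolP (is_right p X i); have [rj|lj] := boolP (is_right p X j).
  - by have := frame_right F ri; have := frame_right F rj; lra.
  - exact: (left_lt_right2pi pK sg_p F).
  - by have := right_lt_left pK sg_p F rj li; lra.
  - by have := frame_left F li; have := frame_left F lj; lra.
have g0M i : - M%:Z <= g0 i <= M%:Z + 1 by rewrite /g0; have := NM i; case: (is_right _ _ i); lia.
exists m, g; split.
- by rewrite /m; lia.
- split.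
  + by move=> i k; rewrite /g; ring.
  + move=> i j k l; pose a := k - kap i; pose c := l - kap j => le.
    have {}le : key i + 2 * pi * a%:~R <= key j + 2 * pi * c%:~R.
      by rewrite !kapE /a /c !intrB; move: le; lra.
    rewrite /g -/a -/c; have [ac|ca|ac] := ltgtP a c.
    * have : m%:Z * (a + 1) <= m%:Z * c by rewrite ler_wpM2l //; lia.
      by have := g0M i; have := g0M j; rewrite /m; lia.
    * have : (c + 1)%:~R <= a%:~R :> R by rewrite ler_int; lia.
      have := key_width i j; move: le; rewrite intrD mulr1z => l1 l2 l3.
      have l4 : 2 * pi * (c%:~R + 1) <= 2 * pi * a%:~R :> R by rewrite ler_pM2l //; lra.
      by move: l2; rewrite ltNge => /negP[]; lra.
    * by move: le; rewrite ac !lerD2r => /g0mono.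
  + have par i k : (2 %| g i k)%Z = ~~ (sg i (+) b).
      rewrite /g; have -> : m%:Z * (k - kap i) = 2 * ((M%:Z + 1) * (k - kap i)) by rewrite /m;
        lia.
      move: (_ * (k - kap i)) => x; rewrite /g0; have := N2 i; rewrite /tau.
      by case: (is_right _ _ i); case: (sg i); case: (b) => /=; lia.
    move=> i j k l; have := par i k; have := par j l.
    by case: (sg i); case: (sg j); case: (b) => /=; lia.
  + move=> v; pose r := ((v + M%:Z) %% m)%Z - M%:Z; pose q := ((v + M%:Z) %/ m)%Z.
    have vE : v = r + m%:Z * q by have := divz_eq (v + M%:Z) m; rewrite /r /q; lia.
    have m0 : m%:Z != 0 by rewrite /m; lia.
    have rM : - M%:Z <= r <= M%:Z + 1.
      have := modz_ge0 (v + M%:Z) m0; have := ltz_pmod (v + M%:Z) (_ : 0 < m%:Z).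
      by rewrite /r /m; lia.
    have [i iE] : exists i, g0 i = r.
      have [r0|r0] := lerP r 0.
        have le : (`|r|%N <= N iM)%N by rewrite -MN; lia.
        have [i Ni] := N3 iM _ le; exists (if is_right p X i then i else p i).
        by have [ri|li] := boolP (is_right p X i); rewrite /g0 ?ri ?rp ?li ?Np Ni; lia.
      have le : (`|r - 1|%N <= N iM)%N by rewrite -MN; lia.
      have [i Ni] := N3 iM _ le; exists (if is_right p X i then p i else i).
      by have [ri|li] := boolP (is_right p X i); rewrite /g0 ?rp ?ri ?(negPf li) ?Np Ni /=; lia.
    by exists i, (q + kap i); rewrite /g iE vE; congr (_ + _ * _); ring.
- move=> i; rewrite /g; apply/dvdzP; exists (- kap i - kap (p i)).
  have -> : g0 (p i) = 1 - g0 i.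
    by rewrite /g0 rp Np; case: (is_right _ _ i) => /=; ring.
  by ring.
Qed.
End Existence.
End Labelling.

(** * A labelling for each direction *)

Lemma shift_2pi (R : realType) (t c : R) : exists k : int, c <= t + 2 * pi * k%:~R < c + 2 * pi.
Proof.
have T : 0 < 2 * pi :> R by rewrite mulr_gt0 ?pi_gt0.
pose k := Num.floor ((t - c) / (2 * pi)); exists (- k).
have /andP[k1 k2] := floor_itv ((t - c) / (2 * pi)).
move: k1 k2; rewrite ler_pdivlMr // ltr_pdivrMr // -/k intrD mulr1z mulrNz => k1 k2.
by apply/andP; split; lra.
Qed.

Lemma cos2pi_shift (R : realType) (t : R) (k : int) : cos (t + 2 * pi * k%:~R) = cos t.
Proof. by apply: periodic_int => x; rewrite mulr_natl cosD2pi. Qed.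

Lemma sin2pi_shift (R : realType) (t : R) (k : int) : sin (t + 2 * pi * k%:~R) = sin t.
Proof. by apply: periodic_int => x; rewrite mulr_natl sinD2pi. Qed.

Lemma ler_2pi_int (R : realType) (a b : int) :
  2 * pi * a%:~R < 2 * pi * b%:~R + 2 * pi :> R -> a <= b.
Proof.
rewrite -[X in _ + X]mulr1 -mulrDr ltr_pM2l ?mulr_gt0 ?pi_gt0 //.
by rewrite -[X in _ + X](mulr1z 1) -intrD ltr_int ltzD1.
Qed.

Section Direction.
Variables (R : realType) (I : finType) (sg : I -> bool) (v1 v2 r alpha : I -> R).
Hypotheses (r_gt0 : forall i, 0 < r i)
  (v1E : forall i, v1 i = r i * cos (alpha i)) (v2E : forall i, v2 i = r i * sin (alpha i)).
Hypothesis UM : unmixed sg v1 v2.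
Variables (p : I -> I) (a b : R).
Hypotheses (pK : involutive p) (sg_p : forall i, sg (p i) = ~~ sg i).
Hypotheses (ab1 : a ^+ 2 + b ^+ 2 = 1)
  (abp : forall i, a * v2 (p i) - b * v1 (p i) = a * v2 i - b * v1 i).

Lemma direction_labelling (i0 : I) :
  \sum_(i | sg i) v1 i = 0 -> \sum_(i | sg i) v2 i = 0 ->
  \sum_(i | ~~ sg i) v1 i = 0 -> \sum_(i | ~~ sg i) v2 i = 0 ->
  exists m g, [/\ (3 < m)%N, labelling sg alpha m g
  & forall i, (m %| g i 0 + g (p i) 0 - 1)%Z].
Proof.
move=> s11 s12 s21 s22.
pose X i := a * v1 i + b * v2 i; pose Y i := a * v2 i - b * v1 i.
have [beta aE bE] : exists2 beta, a = cos beta & b = sin beta.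
  have [|s [beta [s0 _ aE bE]]] := @polar R a b.
    by apply: contra_eqT ab1; rewrite negb_or !negbK => /andP[/eqP -> /eqP ->];
      rewrite expr0n addr0 eq_sym oner_eq0.
  have s1 : s = 1.
    apply/eqP; rewrite -(@eqrXn2 _ 2) // ?ler01 ?ltW // expr1n -ab1 aE bE !exprMn -mulrDr.
    by rewrite cos2Dsin2 mulr1.
  by exists beta; rewrite ?aE ?bE s1 mul1r.
have XE i : X i = r i * cos (alpha i - beta) by rewrite cosB /X v1E v2E aE bE; ring.
have YE i : Y i = r i * sin (alpha i - beta) by rewrite sinB /Y v1E v2E aE bE; ring.
have UMX : unmixed sg X Y.
  move=> i j k s t sij ski s0 t0 st Xk Yk; apply: (UM (i := i) (j := j) (k := k) (s := s) (t :=
    t)) => //.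
    have inv l : v1 l = a * X l - b * Y l.
      by rewrite /X /Y -[LHS]mul1r -ab1; ring.
    by rewrite !inv Xk Yk; ring.
  have inv l : v2 l = b * X l + a * Y l.
    by rewrite /X /Y -[LHS]mul1r -ab1; ring.
  by rewrite !inv Xk Yk; ring.
have pi0 := pi_gt0 R.
have [key keyP] : exists key : I -> R, forall i,
    (if is_right p X i then - pi <= key i < pi else 0 <= key i < 2 * pi) /\
    exists k : int, key i = alpha i + (- beta) + 2 * pi * k%:~R.
  suff /boolp.choice[key keyP] : forall i, exists key : R,
    (if is_right p X i then - pi <= key < pi else 0 <= key < 2 * pi) /\
    exists k : int, key = alpha i + (- beta) + 2 * pi * k%:~R by exists key.
  move=> i; have [k] := shift_2pi (alpha i - beta) (if is_right p X i then - pi else 0).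
  move=> kP; exists (alpha i - beta + 2 * pi * k%:~R); split; last by exists k.
  by move: kP; case: (is_right _ _ i); lra.
have XK i : X i = r i * cos (key i) by have [_ [k ->]] := keyP i; rewrite cos2pi_shift.
have YK i : Y i = r i * sin (key i) by have [_ [k ->]] := keyP i; rewrite sin2pi_shift.
have F : frame sg p X Y key.
  split=> //.
  - by move=> i; exists (r i).
  - move=> i ri; have [] := keyP i; rewrite ri => /andP[k1 k2] _.
    rewrite k2 andbT lt_neqAle k1 andbT; apply/eqP => kpi.
    have Y0 : Y i = 0 by rewrite YK -kpi sinN sinpi oppr0 mulr0.
    have [] := zero_level sg_p UMX abp Y0 ri.
    by rewrite XK -kpi cosN cospi; have := r_gt0 i; lra.
  - move=> i li; have [] := keyP i; rewrite (negPf li) => /andP[k1 k2] _.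
    rewrite k2 andbT lt_neqAle k1 andbT; apply/eqP => k0.
    have Y0 : Y (p i) = 0 by rewrite /Y abp -/(Y i) YK -k0 sin0 mulr0.
    have rpi : is_right p X (p i) by rewrite (right_p pK sg_p UMX abp).
    have [_] := zero_level sg_p UMX abp Y0 rpi.
    by rewrite pK (XK i) -k0 cos0 mulr1 ltNge ltW.
apply: (labelling_exists pK sg_p F (fun i => (keyP i).2) i0).
by rewrite /X !big_split /= -!mulr_sumr s11 s12 s21 s22.
Qed.
End Direction.

(** * The first Fourier mode is not degenerate *)

Section Nondegenerate.
Variables (R : realType) (I : finType) (sg : I -> bool) (v1 v2 r alpha : I -> R).
Hypotheses (r_gt0 : forall i, 0 < r i)
  (v1E : forall i, v1 i = r i * cos (alpha i)) (v2E : forall i, v2 i = r i * sin (alpha i)).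
Variables (m : nat) (g : I -> int -> int).
Hypotheses (m3 : (3 < m)%N) (L : labelling sg alpha m g) (i0 : I).

(** The integer e is the value at gamma of the labelling, seen as a step
    function of the angle. *)
Lemma labelling_step (gamma : R) : exists e : int,
  [/\ exists i (k : int), alpha i + 2 * pi * k%:~R <= gamma /\ g i k = e,
    forall i (k : int), alpha i + 2 * pi * k%:~R <= gamma -> g i k <= e
    & forall i (k : int), gamma <= alpha i + 2 * pi * k%:~R -> e <= g i k].
Proof.
have pi0 := pi_gt0 R.
have /boolp.choice[kap kapP] : forall i, exists k : int,
  gamma - 2 * pi < alpha i + 2 * pi * k%:~R <= gamma.
  move=> i; have [k /andP[k1 k2]] := shift_2pi (- alpha i) (- gamma); exists (- k).
  by rewrite mulrNz; apply/andP; split; lra.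
have [j _ jmax] := @arg_maxP _ _ _ i0 predT (fun i => g i (kap i)) isT.
have /andP[_ kj] := kapP j.
exists (g j (kap j)); split.
- by exists j, (kap j).
- move=> i k ik; apply: le_trans (jmax i isT); apply: (lab_mono L).
  have /andP[k1 _] := kapP i; rewrite lerD2l ler_pM2l ?mulr_gt0 // ler_int.
  by apply: (@ler_2pi_int R); lra.
- by move=> i k ik; apply: (lab_mono L); apply: le_trans ik.
Qed.

Let th i : R := 2 * pi * (g i 0)%:~R / m%:R.

(** The linear form f = l1 v1 + l2 v2 is positive on the half-circle between
    gamma and gamma + pi and negative on the other one.  Let e0 and e1 be the
    labels reached at these two angles.  The trigonometric polynomial of degree
    one in 2 pi x / m given by
    h = sin (pi (x - e0) / m) * sin (pi (e1 - x) / m) changes sign exactly at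
    x = e0 and x = e1, so that f * h is non-negative; yet its sum is a
    combination of the sums that vanish.  As m > 3, some cluster is different
    from e0 and e1, and its points give positive terms. *)
Lemma moments_nondegenerate (l1 l2 : R) :
  \sum_i v1 i = 0 -> \sum_i v2 i = 0 ->
  \sum_i (l1 * v1 i + l2 * v2 i) * cos (th i) = 0 ->
  \sum_i (l1 * v1 i + l2 * v2 i) * sin (th i) = 0 -> (l1 == 0) && (l2 == 0).
Proof.
move=> s1 s2 sc ss; apply: contraT; rewrite negb_and => l0.
have m0 : 0 < m%:R :> R by rewrite ltr0n ltnW // ltnW // ltnW.
have mZ : m%:Z%:~R = m%:R :> R by [].
have mn0 : m%:R != 0 :> R by rewrite gt_eqF.
have pi0 := pi_gt0 R.
pose f i := l1 * v1 i + l2 * v2 i.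
have [|rho [gamma [rho0 _ l2E l1E]]] := @polar R l2 (- l1); first by rewrite oppr_eq0 orbC.
have fE i : f i = rho * (r i * sin (alpha i - gamma)).
  by rewrite /f v1E v2E sinB l2E -[l1]opprK l1E; ring.
(* gamma is the direction in which f vanishes before becoming positive *)
have [e0 [att0 le0 ge0]] := labelling_step gamma.
have [e1 [att1 le1 ge1]] := labelling_step (gamma + pi).
have le0' i (k : int) : alpha i + 2 * pi * k%:~R <= gamma + 2 * pi -> g i k <= e0 + m%:Z.
  move=> ik; have := le0 i (k - 1); rewrite intrB mulr1z (lab_shift L) (lab_shift L i k) => H.
  suff : g i 0 + m%:Z * (k - 1) <= e0 by lia.
  by apply: H; lra.
have e01 : e0 <= e1 <= e0 + m%:Z.
  apply/andP; split.
    by have [i [k [ik <-]]] := att0; apply: le1; lra.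
  by have [i [k [ik <-]]] := att1; apply: le0'; lra.
have /boolp.choice[kap kapP] : forall i, exists k : int,
  gamma <= alpha i + 2 * pi * k%:~R < gamma + 2 * pi.
  by move=> i; exact: shift_2pi.
pose x i : int := g i (kap i).
pose P (e : int) : R := pi * e%:~R / m%:R.
pose h i := sin (P (x i - e0)) * sin (P (e1 - x i)).
have Pge0 e : 0 <= e -> 0 <= P e by move=> ?; rewrite /P divr_ge0 ?mulr_ge0 ?(ltW pi0) ?(ltW
  m0) ?ler0z.
have Plepi e : e <= m%:Z -> P e <= pi.
  by move=> em; rewrite /P ler_pdivrMr // ler_pM2l // -mZ ler_int.
have Pgt0 e : 0 < e -> 0 < P e by move=> ?; rewrite /P divr_gt0 ?mulr_gt0 ?ltr0z.
have Pltpi e : e < m%:Z -> P e < pi.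
  by move=> em; rewrite /P ltr_pdivrMr // ltr_pM2l // -mZ ltr_int.
have sinP_ge0 e : 0 <= e <= m%:Z -> 0 <= sin (P e).
  by move=> /andP[? ?]; rewrite sin_ge0_pi // Pge0 //= Plepi.
have sinP_gt0 e : 0 < e < m%:Z -> 0 < sin (P e).
  by move=> /andP[? ?]; rewrite sin_gt0_pi // Pgt0 //= Pltpi.
have sinPN e : sin (P (- e)) = - sin (P e) by rewrite /P mulrNz mulrN mulNr sinN.
have sum0 : \sum_i f i * h i = 0.
  pose phi := P (e0 + e1); pose C := cos (P (e1 - e0)).
  have hE i : h i = 2^-1 * (cos (th i) * cos phi + sin (th i) * sin phi - C).
    have thE : cos (th i - phi) = cos (P (x i - e0) - P (e1 - x i)).
      rewrite -[RHS](cos2pi_shift _ (- kap i)); congr cos.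
      by rewrite /th /phi /P /x (lab_shift L i (kap i)) !intrB !intrD intrM mulrNz mZ; field.
    rewrite -cosB thE /C (_ : P (e1 - e0) = P (x i - e0) + P (e1 - x i)).
      by rewrite cosB cosD /h; field.
    by rewrite /P -mulrDl -mulrDr -intrD; congr (_ * _%:~R / _); ring.
  have -> : \sum_i f i * h i = 2^-1 * (cos phi * (\sum_i f i * cos (th i)) +
     sin phi * (\sum_i f i * sin (th i)) - C * (l1 * (\sum_i v1 i) + l2 * (\sum_i v2 i))).
    rewrite !mulr_sumr -!big_split /= mulr_sumr -sumrB mulr_sumr; apply: eq_bigr => i _.
    by rewrite hE /f; ring.
  by rewrite sc ss s1 s2; ring.
pose key i := alpha i + 2 * pi * (kap i)%:~R.
have fK i : f i = rho * (r i * sin (key i - gamma)).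
  rewrite fE -(sin2pi_shift _ (kap i)); congr (_ * (_ * sin _)); rewrite /key; ring.
have x_in i : e0 <= x i <= e0 + m%:Z.
  by have /andP[k1 k2] := kapP i; rewrite /x ge0 // le0' // ltW.
have fh_ge0 i : 0 <= f i * h i.
  have /andP[k1 k2] := kapP i; have xi := x_in i; rewrite -/(key i) in k1 k2.
  have S1 : 0 <= sin (P (x i - e0)) by apply: sinP_ge0; lia.
  rewrite fK /h; have [kp|kp] := lerP (key i) (gamma + pi).
    have x1 : x i <= e1 by exact: le1.
    rewrite !mulr_ge0 ?(ltW rho0) ?(ltW (r_gt0 i)) //; last by apply: sinP_ge0; lia.
    by rewrite sin_ge0_pi //; lra.
  have x1 : e1 <= x i by apply: ge1; rewrite ltW.
  have -> : rho * (r i * sin (key i - gamma)) * (sin (P (x i - e0)) * sin (P (e1 - x i))) =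
      rho * (r i * sin (key i - (gamma + pi))) * (sin (P (x i - e0)) * sin (P (x i - e1))).
    rewrite -(opprB (x i)) sinPN opprD addrA [in RHS]sinB cospi sinpi; ring.
  rewrite !mulr_ge0 ?(ltW rho0) ?(ltW (r_gt0 i)) //; last by apply: sinP_ge0; lia.
  by rewrite sin_ge0_pi //; lra.
(* m > 3 leaves room for a label other than e0, e1 and e0 + m *)
have [z [z0 zm ze1]] : exists z : int, [/\ e0 < z, z < e0 + m%:Z & z != e1].
  by have [->|ne] := eqVneq e1 (e0 + 1); [exists (e0 + 2)|exists (e0 + 1)]; split; lia.
have [i [k' iz]] := lab_onto L z.
have key1 : gamma < alpha i + 2 * pi * k'%:~R.
  by rewrite ltNge; apply/negP => /le0; rewrite iz; lia.
have key2 : alpha i + 2 * pi * k'%:~R < gamma + 2 * pi.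
  rewrite ltNge; apply/negP => le; have := ge0 i (k' - 1).
  rewrite intrB mulr1z (lab_shift L) => H.
  have : e0 <= g i 0 + m%:Z * (k' - 1) by apply: H; lra.
  by move: iz zm; rewrite (lab_shift L); clear; lia.
have kapE : kap i = k'.
  by have /andP[k1 k2] := kapP i; apply/eqP; rewrite eq_le; apply/andP; split;
    apply: (@ler_2pi_int R); lra.
have xz : x i = z by rewrite /x kapE.
have keyE : key i = alpha i + 2 * pi * k'%:~R by rewrite /key kapE.
rewrite -keyE in key1 key2.
suff fh_gt0 : 0 < f i * h i.
  have : 0 < \sum_i f i * h i by rewrite (bigD1 i) //= ltr_pwDl // sumr_ge0.
  by rewrite sum0 ltxx.
have S1 : 0 < sin (P (x i - e0)) by apply: sinP_gt0; lia.
rewrite fK /h; have [kp|kp|kp] := ltgtP (key i) (gamma + pi).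
- have x1 : x i <= e1 by apply: le1; rewrite -/(key i) ltW.
  rewrite !mulr_gt0 //; last by apply: sinP_gt0; lia.
  by rewrite sin_gt0_pi //; lra.
- have x1 : e1 <= x i by apply: ge1; rewrite -/(key i) ltW.
  have -> : rho * (r i * sin (key i - gamma)) * (sin (P (x i - e0)) * sin (P (e1 - x i))) =
      rho * (r i * sin (key i - (gamma + pi))) * (sin (P (x i - e0)) * sin (P (x i - e1))).
    rewrite -(opprB (x i)) sinPN opprD addrA [in RHS]sinB cospi sinpi; ring.
  rewrite !mulr_gt0 //; last by apply: sinP_gt0; lia.
  by rewrite sin_gt0_pi //; lra.
have x1 : e1 <= x i by apply: ge1; rewrite -/(key i) kp.
have x2 : x i <= e1 by apply: le1; rewrite -/(key i) kp.
by move: ze1; rewrite -xz eq_le x1 x2.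
Qed.
End Nondegenerate.

(** * Directions as images of roots of unity *)

(** The hypothesis says that the vector (a j, b j) is proportional to
    T - w j * S, and the determinant of T - w i * S and T - w j * S is
    (w j - w i) * det(S, T). *)
Lemma proportional_moebius (F : fieldType) (J : Type) (a b w : J -> F) (T1 T2 S1 S2 : F) :
  (forall j, a j * (T2 - w j * S2) = b j * (T1 - w j * S1)) ->
  (forall j, (a j != 0) || (b j != 0)) -> T2 * S1 - T1 * S2 != 0 ->
  exists2 mu : J -> F, forall j, mu j != 0 & forall i j,
    a i * b j - a j * b i = mu i * mu j * (w j - w i) * (T2 * S1 - T1 * S2).
Proof.
move=> abw ab0 D0.
suff /boolp.choice[mu muP] : forall j, exists mu : F,
    [/\ mu != 0, a j = mu * (T1 - w j * S1) & b j = mu * (T2 - w j * S2)].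
  exists mu => [j|i j]; first by have [] := muP j.
  by have [_ -> ->] := muP i; have [_ -> ->] := muP j; ring.
move=> j; have := abw j; have := ab0 j.
have [P0|P0] := eqVneq (T1 - w j * S1) 0; last first.
  move=> ab E; exists (a j / (T1 - w j * S1)).
  have bE : b j = a j / (T1 - w j * S1) * (T2 - w j * S2) by rewrite mulrAC E mulfK.
  split; rewrite ?divfK //; apply: contraTneq ab => q0.
  have a0 : a j = 0 by apply/eqP; move/eqP: q0; rewrite mulf_eq0 invr_eq0 (negPf P0) orbF.
  by rewrite bE a0 !mul0r eqxx.
have Q0 : T2 - w j * S2 != 0.
  apply: contraNneq D0 => Q0; move/eqP: P0; rewrite subr_eq0 => /eqP ->.
  by move/eqP: Q0; rewrite subr_eq0 => /eqP ->; apply/eqP; ring.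
rewrite P0 mulr0 => ab /eqP; rewrite mulf_eq0 (negPf Q0) orbF => /eqP a0.
exists (b j / (T2 - w j * S2)); split; rewrite ?P0 ?mulr0 ?divfK //.
by move: ab; rewrite a0 eqxx /= => b0; rewrite mulf_neq0 // invr_eq0.
Qed.

Section Directions.
Variables (R : realType) (I : finType) (sg : I -> bool) (v1 v2 : I -> R).
Hypothesis UM : unmixed sg v1 v2.
Variables (J : Type) (j0 : J) (a b : J -> R) (p : J -> I -> I).
Hypotheses (pK : forall j, involutive (p j)) (sg_p : forall j i, sg (p j i) = ~~ sg i).
Hypotheses (ab1 : forall j, a j ^+ 2 + b j ^+ 2 = 1)
  (abp : forall j i, a j * v2 (p j i) - b j * v1 (p j i) = a j * v2 i - b j * v1 i).

(** T = (T1, T2) is the first Fourier mode of the clusters and S is its complex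
    conjugate.  The pairing along (a j, b j) preserves the form
    a j * v2 - b j * v1 and maps the label x to c j - x, which gives
    a j * T2 - b j * T1 = w j * (a j * S2 - b j * S1). *)
Lemma cross_products_roots_of_unity (i0 : I) :
  \sum_(i | sg i) v1 i = 0 -> \sum_(i | sg i) v2 i = 0 ->
  \sum_(i | ~~ sg i) v1 i = 0 -> \sum_(i | ~~ sg i) v2 i = 0 ->
  exists (m : nat) (w mu : J -> R[i]) (D : R[i]),
  [/\ (0 < m)%N, forall j, w j ^+ m = 1, forall j, mu j != 0, D != 0
    & forall i j, (a i * b j - a j * b i)%:C%C = mu i * mu j * (w j - w i) * D].
Proof.
move=> s11 s12 s21 s22.
have v_neq0 i : (v1 i != 0) || (v2 i != 0).
  rewrite -negb_and; apply/negP => /andP[/eqP z1 /eqP z2].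
  apply: (UM (i := p j0 i) (j := p j0 i) (k := i) (s := 0) (t := 0));
    rewrite ?mul0r ?addr0 ?sg_p //; by case: (sg i).
have /boolp.choice[ra raP] : forall i, exists ra : R * R,
    [/\ 0 < ra.1, v1 i = ra.1 * cos ra.2 & v2 i = ra.1 * sin ra.2].
  by move=> i; have [r [al [r0 _ E1 E2]]] := polar (v_neq0 i); exists (r, al).
pose r i := (ra i).1; pose al i := (ra i).2.
have r_gt0 i : 0 < r i by have [] := raP i.
have v1E i : v1 i = r i * cos (al i) by have [] := raP i.
have v2E i : v2 i = r i * sin (al i) by have [] := raP i.
have lab j := direction_labelling r_gt0 v1E v2E UM (pK j) (sg_p j) (ab1 j) (abp j) i0 s11 s12
  s21 s22.
have [m [g [m3 L _]]] := lab j0.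
have m_gt0 : (0 < m)%N by rewrite (leq_trans _ m3).
have mn0 : m%:R != 0 :> R by rewrite pnatr_eq0 -lt0n.
(* By uniqueness the labelling of each direction j is the base labelling g plus
   a constant d, which turns the reflection x |-> 1 - x of the former into
   x |-> 1 - 2 d - x; the constant is reduced modulo m to a natural number. *)
have /boolp.choice[c cP] : forall j, exists c : nat, forall i,
  (m %| g i 0 + g (p j i) 0 - c%:Z)%Z.
  move=> j; have [m' [g' [m3' L' pg']]] := lab j.
  have E := labelling_unique L L'.
  have mE : m' = m.
    have := E i0 i0 0 1; rewrite (lab_shift L _ 1) (lab_shift L' _ 1) !mulr1.
    by rewrite ![_ 0 + _]addrC !addrK => -[].
  pose d := g' i0 0 - g i0 0; exists `|((1 - d - d) %% m)%Z|%N => i.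
  have mz : m%:Z != 0 by lia.
  rewrite gez0_abs ?modz_ge0 //; have := pg' i; rewrite mE => /dvdzP[q qE].
  apply/dvdzP; exists (q + ((1 - d - d) %/ m)%Z).
  have E1 : g' i 0 = g i 0 + d by have := E i0 i 0 0; rewrite /d; lia.
  have E2 : g' (p j i) 0 = g (p j i) 0 + d by have := E i0 (p j i) 0 0; rewrite /d; lia.
  by rewrite E1 E2 in qE; rewrite mulrDl -qE /modz; ring.
pose th i : R := 2 * pi * (g i 0)%:~R / m%:R.
pose w j : R[i] := zetaC R m ^+ c j.
pose ph j : R := (c j)%:R * (2 * pi / m%:R).
have wE j : w j = (cos (ph j) +i* sin (ph j))%C by rewrite /w zetaCX.
pose A1 := \sum_i v1 i * cos (th i); pose B1 := \sum_i v1 i * sin (th i).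
pose A2 := \sum_i v2 i * cos (th i); pose B2 := \sum_i v2 i * sin (th i).
have thp j i : exists k : int, th (p j i) = ph j - th i + 2 * pi * k%:~R.
  have /dvdzP[k kE] := cP j i; exists k.
  have E : (g (p j i) 0)%:~R = k%:~R * m%:R + (c j)%:R - (g i 0)%:~R :> R.
    have -> : g (p j i) 0 = k * m%:Z + (c j)%:Z - g i 0 by rewrite -kE; ring.
    by rewrite intrB intrD intrM.
  by rewrite /th /ph E; field.
have cos_thp j i : cos (th (p j i)) = cos (ph j) * cos (th i) + sin (ph j) * sin (th i).
  by have [k ->] := thp j i; rewrite cos2pi_shift cosB.
have sin_thp j i : sin (th (p j i)) = sin (ph j) * cos (th i) - cos (ph j) * sin (th i).
  by have [k ->] := thp j i; rewrite sin2pi_shift sinB.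
have lin j (F : I -> R) : a j * (\sum_i v2 i * F i) - b j * (\sum_i v1 i * F i) =
    \sum_i (a j * v2 i - b j * v1 i) * F i.
  by rewrite !mulr_sumr -sumrB; apply: eq_bigr => i _; ring.
have refl j (F : I -> R) : \sum_i (a j * v2 i - b j * v1 i) * F i =
    \sum_i (a j * v2 i - b j * v1 i) * F (p j i).
  by rewrite (reindex_inj (inv_inj (pK j))) /=; apply: eq_bigr => i _; rewrite abp.
have YA j : a j * A2 - b j * A1 =
    cos (ph j) * (a j * A2 - b j * A1) + sin (ph j) * (a j * B2 - b j * B1).
  rewrite [LHS](lin j (fun i => cos (th i))) refl.
  rewrite /A2 /A1 /B2 /B1 !lin !mulr_sumr -big_split /=; apply: eq_bigr => i _;
    rewrite cos_thp; ring.
have YB j : a j * B2 - b j * B1 =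
    sin (ph j) * (a j * A2 - b j * A1) - cos (ph j) * (a j * B2 - b j * B1).
  rewrite [LHS](lin j (fun i => sin (th i))) refl.
  rewrite /A2 /A1 /B2 /B1 !lin !mulr_sumr -sumrB /=; apply: eq_bigr => i _; rewrite sin_thp; ring.
have sv1 : \sum_i v1 i = 0 by rewrite (bigID sg) /= s11 s21 addr0.
have sv2 : \sum_i v2 i = 0 by rewrite (bigID sg) /= s12 s22 addr0.
have nd (l1 l2 : R) : l1 * A1 + l2 * A2 = 0 -> l1 * B1 + l2 * B2 = 0 -> l1 = 0 /\ l2 = 0.
  have lin2 (F : I -> R) : l1 * (\sum_i v1 i * F i) + l2 * (\sum_i v2 i * F i) =
      \sum_i (l1 * v1 i + l2 * v2 i) * F i.
    by rewrite !mulr_sumr -big_split; apply: eq_bigr => i _ /=; ring.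
  rewrite /A1 /A2 /B1 /B2 !lin2 => n1 n2.
  have := moments_nondegenerate r_gt0 v1E v2E m3 L i0 sv1 sv2 n1 n2.
  by case/andP=> /eqP -> /eqP ->.
have D0 : A1 * B2 - A2 * B1 != 0.
  apply/eqP => D0; have [a2 a1] : A2 = 0 /\ - A1 = 0 by apply: nd;
    [ring|rewrite -[RHS]oppr0 -D0; ring].
  have [b2 b1] : B2 = 0 /\ - B1 = 0 by apply: nd; [rewrite -[RHS]D0; ring|ring].
  have [] : (1 : R) = 0 /\ (0 : R) = 0.
    apply: nd; first by rewrite a2 -[A1]opprK a1; ring.
    by rewrite b2 -[B1]opprK b1; ring.
  by move=> /eqP; rewrite oner_eq0.
pose T1 : R[i] := (A1 +i* B1)%C; pose T2 : R[i] := (A2 +i* B2)%C.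
pose S1 : R[i] := (A1 +i* - B1)%C; pose S2 : R[i] := (A2 +i* - B2)%C.
have DE : T2 * S1 - T1 * S2 != 0.
  rewrite eq_complex /= negb_and; apply/orP; right.
  apply: contra_neq D0 => D1; apply: (mulfI (_ : 2 != 0 :> R)); first by rewrite pnatr_eq0.
  by rewrite mulr0 -[RHS]D1; ring.
have abw j : (a j)%:C%C * (T2 - w j * S2) = (b j)%:C%C * (T1 - w j * S1).
  rewrite wE; apply/eqP; rewrite eq_complex /=; apply/andP; split; rewrite -subr_eq0; apply/eqP.
    by have /eqP := YA j; rewrite -subr_eq0 => /eqP E; rewrite -[RHS]E; ring.
  by have /eqP := YB j; rewrite -subr_eq0 => /eqP E; rewrite -[RHS]E; ring.
have ab0 j : ((a j)%:C%C != 0) || ((b j)%:C%C != 0).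
  rewrite -negb_and !eq_complex /= !eqxx !andbT; apply: contra_eqN (ab1 j) => /andP[/eqP ->
    /eqP ->].
  by rewrite expr0n addr0 eq_sym oner_eq0.
have [mu mu0 muE] := proportional_moebius abw ab0 DE.
exists m, w, mu, (T2 * S1 - T1 * S2); split=> //.
  by move=> j; rewrite /w -exprM mulnC exprM (prim_expr_order (zetaC_prim R m_gt0)) expr1n.
by move=> i j; rewrite -muE rmorphB !rmorphM.
Qed.
End Directions.

(** * Convex sets with the same X-rays *)

(** Within a level set, the k-th element of one kind is paired with the k-th
    element of the other kind. *)
Lemma matching_exists (T : eqType) (I : finType) (sg : I -> bool) (Y : I -> T) :
  (forall h, #|[pred i | sg i & Y i == h]| = #|[pred i | ~~ sg i & Y i == h]|) ->
  exists p : I -> I, [/\ involutive p, forall i, sg (p i) = ~~ sg i & forall i, Y (p i) = Y i].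
Proof.
move=> card_lvl; pose cls b h := [pred i | sg i == b & Y i == h].
have clsE b h : #|cls b h| = #|cls (~~ b) h|.
  have tE h' : #|cls true h'| = #|[pred i | sg i & Y i == h']|.
    by apply: eq_card => i; rewrite !inE eqb_id.
  have fE h' : #|cls false h'| = #|[pred i | ~~ sg i & Y i == h']|.
    by apply: eq_card => i; rewrite !inE eqbF_neg.
  by case: b; rewrite /= tE fE card_lvl.
have in_cls i : i \in cls (sg i) (Y i) by rewrite inE !eqxx.
pose p i := nth i (enum (cls (~~ sg i) (Y i))) (index i (enum (cls (sg i) (Y i)))).
have lt i : (index i (enum (cls (sg i) (Y i))) < size (enum (cls (~~ sg i) (Y i))))%N.
  by rewrite -cardE -clsE cardE index_mem mem_enum.
have p_in i : p i \in cls (~~ sg i) (Y i) by rewrite -mem_enum mem_nth.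
have sgp i : sg (p i) = ~~ sg i by have := p_in i; rewrite inE => /andP[/eqP].
have Yp i : Y (p i) = Y i by have := p_in i; rewrite inE => /andP[_ /eqP].
exists p; split=> // i; rewrite {1}/p sgp Yp negbK /p index_uniq ?enum_uniq //.
by rewrite nth_index // mem_enum.
Qed.

(** The difference of two slopes is the determinant of the directions divided
    by the product of their abscissas, which cancel in the cross ratio; one
    infinite slope at most has to be treated apart. *)
Lemma cross_ratio_slopes (R : realType) (u1 u2 u3 u4 : plane R) (c : plane R -> plane R -> R) :
  (forall u v, c u v = u.1 * v.2 - v.1 * u.2) ->
  c u1 u2 != 0 -> c u1 u3 != 0 -> c u1 u4 != 0 -> c u2 u3 != 0 -> c u2 u4 != 0 -> c u3 u4 != 0 ->
  cross_ratio (slope u1) (slope u2) (slope u3) (slope u4) =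
  c u1 u3 * c u2 u4 / (c u2 u3 * c u1 u4).
Proof.
move=> cE; have dE (u v : plane R) : u.1 != 0 -> v.1 != 0 ->
    v.2 / v.1 - u.2 / u.1 = c u v / (u.1 * v.1).
  by move=> nu nv; rewrite cE; field; rewrite nu nv.
have c00 u v : u.1 = 0 -> v.1 = 0 -> c u v = 0 by move=> nu nv; rewrite cE nu nv; ring.
have c0l u v : u.1 = 0 -> c u v = - (v.1 * u.2) by move=> nu; rewrite cE nu; ring.
have c0r u v : v.1 = 0 -> c u v = u.1 * v.2 by move=> nv; rewrite cE nv; ring.
move=> c12 c13 c14 c23 c24 c34; rewrite /slope.
have [n1|n1] := eqVneq u1.1 0.
  have [n2|n2] := eqVneq u2.1 0; first by rewrite c00 ?eqxx in c12.
  have [n3|n3] := eqVneq u3.1 0; first by rewrite c00 ?eqxx in c13.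
  have [n4|n4] := eqVneq u4.1 0; first by rewrite c00 ?eqxx in c14.
  rewrite /= !dE //; move: c14; rewrite (c0l u1 u4) // (c0l u1 u3) // oppr_eq0 mulf_eq0 negb_or.
  by case/andP=> _ b1; field; rewrite b1 n4 n3 n2 c23.
have [n2|n2] := eqVneq u2.1 0.
  have [n3|n3] := eqVneq u3.1 0; first by rewrite c00 ?eqxx in c23.
  have [n4|n4] := eqVneq u4.1 0; first by rewrite c00 ?eqxx in c24.
  rewrite /= !dE //; move: c23; rewrite (c0l u2 u4) // (c0l u2 u3) // oppr_eq0 mulf_eq0 negb_or.
  by case/andP=> _ b1; field; rewrite b1 n4 n3 n1 c14.
have [n3|n3] := eqVneq u3.1 0.
  have [n4|n4] := eqVneq u4.1 0; first by rewrite c00 ?eqxx in c34.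
  rewrite /= !dE //; move: c23; rewrite (c0r u2 u3) // (c0r u1 u3) // mulf_eq0 negb_or.
  by case/andP=> _ b1; field; rewrite b1 n4 n2 n1 c14.
have [n4|n4] := eqVneq u4.1 0.
  rewrite /= !dE //; move: c14; rewrite (c0r u2 u4) // (c0r u1 u4) // mulf_eq0 negb_or.
  by case/andP=> _ b1; field; rewrite b1 n3 n2 n1 c23.
by rewrite /= !dE //; field; rewrite n1 n2 n3 n4 c23 c14.
Qed.

Lemma convex_comb (R : realType) (A : set (plane R)) : @convex_set R (plane R) A ->
  forall x y (t : R), A x -> A y -> 0 <= t <= 1 -> A (t *: x + (1 - t) *: y).
Proof.
move=> cA x y t Ax Ay t01; have /andP[t0 t1] := t01.
have := cA x y (Itv01 t0 t1); rewrite !inE; exact.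
Qed.

Lemma convex_comb3 (R : realType) (A : set (plane R)) : @convex_set R (plane R) A ->
  forall o x y (s t : R), A o -> A x -> A y -> 0 <= s -> 0 <= t -> s + t <= 1 ->
  A (o + s *: (x - o) + t *: (y - o)).
Proof.
move=> cA o x y s t Ao Ax Ay s0 t0 st.
have [st0|st_neq0] := eqVneq (s + t) 0.
  have [-> ->] : s = 0 /\ t = 0 by split; lra.
  by rewrite !scale0r !addr0.
have Az : A ((s / (s + t)) *: x + (1 - s / (s + t)) *: y).
  apply: convex_comb => //; rewrite divr_ge0 ?addr_ge0 //= ler_pdivrMr ?mul1r ?lerDl //.
  by rewrite lt_neqAle eq_sym st_neq0 addr_ge0.
have st01 : 0 <= s + t <= 1 by rewrite addr_ge0.
have := convex_comb cA Az Ao st01; congr (A _); apply: injective_projections => /=.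
  by rewrite /GRing.scale /=; field.
by rewrite /GRing.scale /=; field.
Qed.

Lemma convex_mean (R : realType) (A : set (plane R)) : @convex_set R (plane R) A ->
  forall (s : seq (plane R)), (forall x, x \in s -> A x) -> (0 < size s)%N ->
  A ((size s)%:R^-1 *: \sum_(x <- s) x).
Proof.
move=> cA; elim=> // x s IH As _; rewrite big_cons.
have Ax : A x by apply: As; rewrite inE eqxx.
have [/size0nil ->|s0] := posnP (size s).
  by rewrite big_nil addr0 invr1 scale1r.
have As' : A ((size s)%:R^-1 *: \sum_(y <- s) y) by apply: IH => // y ys; apply: As;
  rewrite inE ys orbT.
have n0 : (size s)%:R != 0 :> R by rewrite pnatr_eq0 -lt0n.
have n1 : (size s).+1%:R != 0 :> R by rewrite pnatr_eq0.
have t01 : 0 <= ((size s).+1%:R^-1 : R) <= 1 by rewrite invr_ge0 ler0n /= invf_le1 ?ler1n ?ltr0n.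
have := convex_comb cA Ax As' t01; rewrite scalerA scalerDr; congr (A (_ + _ *: _)).
by rewrite -natr1 in n1 *; field; rewrite n0 n1.
Qed.

Lemma convex_hull_convex (R : realType) (F : set (plane R)) :
  @convex_set R (plane R) (convex_hull F).
Proof.
move=> x y l; rewrite !inE => Fx Fy C [cC FC].
have := cC x y l; rewrite !inE; apply; [exact: Fx|exact: Fy].
Qed.

Lemma count_symdiff (T : choiceType) (X X' : {fset T}) (P : pred T) :
  let D := ((X `\` X') `|` (X' `\` X))%fset in
  #|` [fset x in X | P x]%fset| = #|` [fset x in X' | P x]%fset| ->
  #|[pred i : D | (val i \in X) & P (val i)]| = #|[pred i : D | (val i \notin X) & P (val i)]|.
Proof.
move=> D cXX'.
have H (Q : pred T) (Z : {fset T}) : Z = [fset x in D | Q x]%fset ->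
    #|[pred i : D | Q (val i)]| = #|` Z|.
  by move=> ->; rewrite card_fset_sum1 -big_fset_condE big_seq_fsetE sum1_card.
rewrite (H [pred x | (x \in X) && P x] ([fset x in X | P x] `\` X')%fset); last first.
  by apply/fsetP => x; rewrite !inE /=; case: (x \in X); case: (x \in X'); case: (P x).
rewrite (H [pred x | (x \notin X) && P x] ([fset x in X' | P x] `\` X)%fset); last first.
  by apply/fsetP => x; rewrite !inE /=; case: (x \in X); case: (x \in X'); case: (P x).
apply/eqP; rewrite -(eqn_add2l #|` ([fset x in X | P x] `&` X')%fset|) cardfsID cXX'.
rewrite -(cardfsID X); apply/eqP; congr (_ + _)%N; congr #|` _|.
by apply/fsetP => x; rewrite !inE /=; case: (x \in X); case: (x \in X'); case: (P x).
Qed.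

Definition crossp (R : realType) (u v : plane R) : R := u.1 * v.2 - v.1 * u.2.

Lemma xray_card (R : realType) (u q : plane R) (F : set (plane R)) l :
  unit_circle u -> finite_set F -> sval l = [set q + k *: u | k in [set: R]] ->
  @xray R u F l = #|` [fset x in fset_set F | crossp u x == crossp u q]%fset|.
Proof.
move=> u1 finF lE; rewrite /xray; congr #|` _|; apply/fsetP => x.
rewrite in_fset_set; last by apply: sub_finite_set finF => y [].
rewrite !inE /= in_fset_set // lE; apply/idP/andP.
  rewrite inE => -[/= Fx [k _ xE]]; split; first exact: mem_set.
  by rewrite -xE /crossp /=; apply/eqP; rewrite /GRing.scale /=; ring.
move=> [Fx /eqP xq]; rewrite inE; split; first by rewrite inE in Fx.
move: u1 xq; rewrite /unit_circle /crossp /= => u1 xq.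
exists (u.1 * (x.1 - q.1) + u.2 * (x.2 - q.2)) => //.
apply: injective_projections; rewrite /= /GRing.scale /=; apply/eqP; rewrite -subr_eq0; apply/eqP.
  transitivity ((u.1 ^+ 2 + u.2 ^+ 2 - 1) * (x.1 - q.1) + u.2 * ((u.1 * x.2 - x.1 * u.2) - (u.1
    * q.2 - q.1 * u.2))).
    ring.
  by rewrite u1 xq !subrr; ring.
transitivity ((u.1 ^+ 2 + u.2 ^+ 2 - 1) * (x.2 - q.2) - u.1 * ((u.1 * x.2 - x.1 * u.2) - (u.1 *
  q.2 - q.1 * u.2))).
  ring.
by rewrite u1 xq !subrr; ring.
Qed.

Lemma unit_crossp0 (R : realType) (u v : plane R) : unit_circle u -> unit_circle v ->
  crossp u v = 0 -> parallel u v.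
Proof.
rewrite /unit_circle /crossp /= => u1 v1 uv0; exists (u.1 * v.1 + u.2 * v.2).
  apply/eqP => uv; have : (u.1 ^+ 2 + u.2 ^+ 2) * (v.1 ^+ 2 + v.2 ^+ 2) =
      (u.1 * v.1 + u.2 * v.2) ^+ 2 + (u.1 * v.2 - v.1 * u.2) ^+ 2 by ring.
  by rewrite u1 v1 uv uv0 !expr0n mulr1 addr0 => /eqP; rewrite oner_eq0.
apply: injective_projections; rewrite /= /GRing.scale /=; apply/eqP; rewrite -subr_eq0; apply/eqP.
  transitivity ((1 - (u.1 ^+ 2 + u.2 ^+ 2)) * v.1 - u.2 * (u.1 * v.2 - v.1 * u.2)); first by ring.
  by rewrite u1 uv0; ring.
transitivity ((1 - (u.1 ^+ 2 + u.2 ^+ 2)) * v.2 + u.1 * (u.1 * v.2 - v.1 * u.2)); first by ring.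
by rewrite u1 uv0; ring.
Qed.

Lemma centred_comb (R : realType) (o x y z : plane R) (s t : R) :
  z.1 - o.1 = s * (x.1 - o.1) + t * (y.1 - o.1) ->
  z.2 - o.2 = s * (x.2 - o.2) + t * (y.2 - o.2) ->
  z = o + s *: (x - o) + t *: (y - o).
Proof.
move=> z1 z2; apply: injective_projections; rewrite /= /GRing.scale /=.
  by rewrite -[LHS](subrK o.1) z1; ring.
by rewrite -[LHS](subrK o.2) z2; ring.
Qed.

Section Tomography.
Variables (R : realType) (L F F' : set (plane R)) (U : set (plane R)).
Hypotheses (U1 : forall u, U u -> unit_circle u)
  (Upar : forall u v, U u -> U v -> u <> v -> ~ parallel u v)
  (Uxray : forall u, U u -> @xray R u F =1 @xray R u F').
Hypotheses (cF : convex_subsets L F) (cF' : convex_subsets L F') (FF' : F <> F').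

(** The index type of the configuration is the symmetric difference of F and
    F', and its origin is their common centroid o. *)
Lemma xray_ambiguity u0 u0' : U u0 -> U u0' -> u0 <> u0' ->
  exists (m : nat) (w mu : {u | U u} -> R[i]) (D : R[i]),
  [/\ (0 < m)%N, forall j, w j ^+ m = 1, forall j, mu j != 0, D != 0
    & forall i j, (crossp (sval i) (sval j))%:C%C = mu i * mu j * (w j - w i) * D].
Proof.
move=> Uu0 Uu0' u0u0'.
have [finF FL FE] := cF; have [finF' F'L F'E] := cF'.
pose X := fset_set F; pose X' := fset_set F'.
have XF x : (x \in X) = (x \in F) by rewrite in_fset_set.
have XF' x : (x \in X') = (x \in F') by rewrite in_fset_set.
pose D := ((X `\` X') `|` (X' `\` X))%fset.
have [i0 _] : exists i0 : D, true.
  have /fset0Pn[x xD] : D != fset0.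
    apply: contra_not_neq FF' => D0; apply: fset_set_inj => //; apply/fsetP => x.
    move/fsetP: D0 => /(_ x); rewrite !inE -/X -/X'; by case: (x \in X); case: (x \in X').
  by exists [` xD]%fset.
pose sg (i : D) := val i \in X.
have inD x : (x \in D) = (x \in X) (+) (x \in X').
  by rewrite !inE; case: (x \in X); case: (x \in X').
have sgT i : sg i -> F (val i) /\ ~ F' (val i).
  rewrite /sg => iX; have := valP i; rewrite inD iX addTb XF' => /negP niX.
  by split; [apply: set_mem; rewrite -XF|move=> Fi; apply: niX; apply: mem_set].
have sgN i : ~~ sg i -> F' (val i) /\ ~ F (val i).
  rewrite /sg => iX; have := valP i; rewrite inD (negPf iX) addFb => iX'.
  by split; [apply: set_mem; rewrite -XF'|move=> Fi; move/negP: iX; apply; rewrite XF;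
    apply: mem_set].
have /boolp.choice[p pP] : forall j : {u | U u}, exists p : D -> D,
    [/\ involutive p, forall i, sg (p i) = ~~ sg i &
      forall i, crossp (sval j) (val (p i)) = crossp (sval j) (val i)].
  case=> u Uu /=; apply: matching_exists => h.
  have [[q qh]|nq] := pselect (exists q, crossp u q = h); last first.
    rewrite !eq_card0 // => i; rewrite !inE; apply/negP => /andP[_ /eqP hE];
      by apply: nq; exists (val i).
  have lP : parallel_lines u [set q + k *: u | k in [set: R]] by exists q.
  apply: (count_symdiff (P := [pred x | crossp u x == h])).
  rewrite -qh -(xray_card (l := exist _ _ lP) (U1 Uu) finF erefl) (Uxray Uu).
  exact: (xray_card (l := exist _ _ lP) (U1 Uu) finF' erefl).
have pK j : involutive (p j) by have [] := pP j.
have sg_p j i : sg (p j i) = ~~ sg i by have [_ ->] := pP j.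
have crp j i : crossp (sval j) (val (p j i)) = crossp (sval j) (val i) by have [_ _ ->] := pP j.
pose j0 : {u | U u} := exist _ u0 Uu0; pose j0' : {u | U u} := exist _ u0' Uu0'.
pose n := #|[pred i | sg i]|.
have nE : #|[pred i | ~~ sg i]| = n.
  rewrite /n -!sum1_card [RHS](reindex_inj (inv_inj (pK j0))) /=.
  by apply: eq_bigl => i; rewrite !inE sg_p.
have n_gt0 : (0 < n)%N.
  apply/card_gt0P; have [s|s] := boolP (sg i0); first by exists i0.
  by exists (p j0 i0); rewrite inE sg_p.
have n0 : n%:R != 0 :> R by rewrite pnatr_eq0 -lt0n.
pose SA : plane R := \sum_(i | sg i) val i; pose SB : plane R := \sum_(i | ~~ sg i) val i.
have fst_sum (P : pred D) : (\sum_(i | P i) val i : plane R).1 = \sum_(i | P i) (val i).1.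
  by elim/big_rec2: _ => // i y1 y2 _ <-.
have snd_sum (P : pred D) : (\sum_(i | P i) val i : plane R).2 = \sum_(i | P i) (val i).2.
  by elim/big_rec2: _ => // i y1 y2 _ <-.
have cross_sum (P : pred D) u : \sum_(i | P i) crossp u (val i) = crossp u (\sum_(i | P i) val i).
  by rewrite /crossp fst_sum snd_sum mulr_sumr mulr_suml -sumrB.
(* two independent coordinates of the sums agree, by the pairings along u0, u0' *)
have SAB : SA = SB.
  have cr (j : {u | U u}) : crossp (sval j) SA = crossp (sval j) SB.
    rewrite -!cross_sum [LHS](reindex_inj (inv_inj (pK j))) /=.
    by apply: eq_big => [i|i _]; rewrite ?sg_p ?crp.
  have c0 : crossp u0 u0' != 0.
    by apply/eqP => /(unit_crossp0 (U1 Uu0) (U1 Uu0')); exact: Upar.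
  have c1 := cr j0; have c2 := cr j0'; rewrite /crossp /= in c0 c1 c2.
  apply: injective_projections; apply: (mulfI c0); apply/eqP; rewrite -subr_eq0; apply/eqP.
    transitivity (u0.1 * ((u0'.1 * SA.2 - SA.1 * u0'.2) - (u0'.1 * SB.2 - SB.1 * u0'.2)) * (-1)
      + u0'.1 * ((u0.1 * SA.2 - SA.1 * u0.2) - (u0.1 * SB.2 - SB.1 * u0.2))); first by ring.
    by rewrite c1 c2 !subrr; ring.
  transitivity (u0.2 * ((u0'.1 * SA.2 - SA.1 * u0'.2) - (u0'.1 * SB.2 - SB.1 * u0'.2)) * (-1)
      + u0'.2 * ((u0.1 * SA.2 - SA.1 * u0.2) - (u0.1 * SB.2 - SB.1 * u0.2))); first by ring.
  by rewrite c1 c2 !subrr; ring.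
pose o : plane R := n%:R^-1 *: SA.
have o1E : n%:R * o.1 = SA.1 by exact: mulVKf.
have o2E : n%:R * o.2 = SA.2 by exact: mulVKf.
have mean (P : pred D) (Z : set (plane R)) : #|P| = n -> (forall i, P i -> Z (val i)) ->
    convex_hull Z (n%:R^-1 *: \sum_(i | P i) val i).
  move=> cP PZ; have sP : size [seq val i | i <- enum P] = n by rewrite size_map -cardE.
  have := convex_mean (convex_hull_convex (F := Z)) (s := [seq val i | i <- enum P]).
  rewrite sP big_map big_enum; apply=> // _ /mapP[i iP ->].
  by apply: (@sub_gen_smallest _ _ Z); apply: PZ; rewrite mem_enum in iP.
have oF : convex_hull F o by apply: mean => // i /sgT[].
have oF' : convex_hull F' o by rewrite /o SAB; apply: mean => // i /sgN[].
pose v1 (i : D) : R := (val i).1 - o.1; pose v2 (i : D) : R := (val i).2 - o.2.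
have UM : unmixed sg v1 v2.
  move=> i j k s t sij ski s0 t0 st; rewrite /v1 /v2 => k1 k2.
  have kE : val k = o + s *: (val i - o) + t *: (val j - o).
    exact: centred_comb.
  have in_hull (Z : set (plane R)) : convex_hull Z o -> Z (val i) -> Z (val j) ->
    convex_hull Z (val k).
    move=> Zo Zi Zj; rewrite kE; apply: convex_comb3 => //; first exact: convex_hull_convex.
      exact: (@sub_gen_smallest _ _ Z).
    exact: (@sub_gen_smallest _ _ Z).
  have [si|si] := boolP (sg i).
    have sk : ~~ sg k by move: ski; rewrite si; case: (sg k).
    have [Fk' nFk] := sgN k sk; apply: nFk; rewrite FE; split; last exact: F'L.
    by apply: in_hull => //; [have [] := sgT i si|rewrite sij in si; have [] := sgT j si].
  have sk : sg k by move: ski; rewrite (negPf si); case: (sg k).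
  have [Fk nFk'] := sgT k sk; apply: nFk'; rewrite F'E; split; last exact: FL.
  by apply: in_hull => //; [have [] := sgN i si|rewrite sij in si; have [] := sgN j si].
have sum_v (P : pred D) : #|P| = n -> \sum_(i | P i) val i = SA ->
    \sum_(i | P i) v1 i = 0 /\ \sum_(i | P i) v2 i = 0.
  move=> cP sP; rewrite /v1 /v2 !sumrB !sumr_const cP -fst_sum -snd_sum sP.
  by rewrite -[X in _ - X]mulr_natl o1E -[X in _ = _ /\ _ - X = _]mulr_natl o2E !subrr.
have [s11 s12] := sum_v _ erefl erefl.
have [s21 s22] := sum_v _ nE (esym SAB).
pose a (j : {u | U u}) := (sval j).1; pose b (j : {u | U u}) := (sval j).2.
have ab1 j : a j ^+ 2 + b j ^+ 2 = 1 := U1 (proj2_sig j).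
have abp j i : a j * v2 (p j i) - b j * v1 (p j i) = a j * v2 i - b j * v1 i.
  have := crp j i; rewrite /crossp -/(a j) -/(b j) /v1 /v2 => E.
  transitivity (a j * (val (p j i)).2 - (val (p j i)).1 * b j - (a j * o.2 - o.1 * b j)).
    by ring.
  by rewrite E; ring.
have [m [w [mu [Dl [m_gt0 wm mu0 D0 muE]]]]] :=
  cross_products_roots_of_unity UM j0 pK sg_p ab1 abp i0 s11 s12 s21 s22.
by exists m, w, mu, Dl; split.
Qed.
End Tomography.

Theorem theorem16 (R : realType) (n : nat) (K : cyclotomic_field R n)
    (U : set (plane R)) (u1 u2 u3 u4 : plane R) (x : K) :
  n \in [:: 5; 8; 10; 12]%N ->
  (U #= `I_4)%card ->
  U `<=` integer_directions K ->
  (forall u v, U u -> U v -> u <> v -> ~ parallel u v) ->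
  U = [set u1; u2; u3; u4] ->
  angle u1 < angle u2 -> angle u2 < angle u3 -> angle u3 < angle u4 ->
  x \in real_subfield K ->
  cf_emb K x =
    (cross_ratio (slope u1) (slope u2) (slope u3) (slope u4))%:C%C ->
  ~ (exists2 q : rat, N2 q & real_norm x = ratr q) ->
  forall L : set (plane R), cyclotomic_model_sets K L ->
    determined_by_xrays (convex_subsets L) U.
Proof.
move=> n_in _ Udir Upar UE a12 a23 a34 xK xE xN2 L _ F F' cF cF' FF'.
apply: contrapT => F_neq; apply: xN2.
have U1 u : U u -> unit_circle u by move=> /Udir[].
have Uu1 : U u1 by rewrite UE; left; left; left.
have Uu2 : U u2 by rewrite UE; left; left; right.
have Uu3 : U u3 by rewrite UE; left; right.
have Uu4 : U u4 by rewrite UE; right.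
have neq (u v : plane R) : angle u < angle v -> u <> v by move=> uv E; move: uv; rewrite E ltxx.
have c0 u v : U u -> U v -> angle u < angle v -> crossp u v != 0.
  move=> Uu Uv uv; apply/eqP => uv0; apply: (Upar u v Uu Uv (neq u v uv)).
  exact: (unit_crossp0 (U1 u Uu) (U1 v Uv)).
have a13 := lt_trans a12 a23; have a24 := lt_trans a23 a34; have a14 := lt_trans a12 a24.
have [m [w [mu [D [m_gt0 wm mu0 D0 muE]]]]] :=
  xray_ambiguity U1 Upar FF' cF cF' F_neq Uu1 Uu2 (neq _ _ a12).
pose j1 : {u | U u} := exist _ u1 Uu1; pose j2 : {u | U u} := exist _ u2 Uu2.
pose j3 : {u | U u} := exist _ u3 Uu3; pose j4 : {u | U u} := exist _ u4 Uu4.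
have w_neq i j : crossp (sval i) (sval j) != 0 -> w j != w i.
  apply: contra_neq => wij; apply: (fmorph_inj (real_complex R)).
  by rewrite /= muE wij subrr mulr0 mul0r.
have w31 := w_neq j1 j3 (c0 _ _ Uu1 Uu3 a13); have w42 := w_neq j2 j4 (c0 _ _ Uu2 Uu4 a24).
have w32 := w_neq j2 j3 (c0 _ _ Uu2 Uu3 a23); have w41 := w_neq j1 j4 (c0 _ _ Uu1 Uu4 a14).
apply: (root_of_unity_cross_ratio_norm n_in xK m_gt0 (wm j1) (wm j2) (wm j3) (wm j4)
  w31 w42 w32 w41).
rewrite xE (cross_ratio_slopes (c := @crossp R)) ?c0 //.
have -> (c1 c2 c3 c4 : R) : (c1 * c2 / (c3 * c4))%:C%C = c1%:C%C * c2%:C%C / (c3%:C%C *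
  c4%:C%C) :> R[i].
  by rewrite !rmorphM fmorphV rmorphM.
rewrite (muE j1 j3) (muE j2 j4) (muE j2 j3) (muE j1 j4).
move: (mu j1) (mu j2) (mu j3) (mu j4) (mu0 j1) (mu0 j2) (mu0 j3) (mu0 j4) w32 w41.
move: (w j1) (w j2) (w j3) (w j4) => y1 y2 y3 y4 z1 z2 z3 z4 z10 z20 z30 z40 y32 y41.
by field; rewrite D0 z10 z20 z30 z40 !subr_eq0 y32 y41.
Qed.
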